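(* There exists a non-trivial, non-negative function $\tilde W\in L^1(\mathbb{R}^2)$ such that $R_1^2(\tilde W)$ is non-negative on the support of $\tilde W$.
   Context: $R_1$ denotes the first component of the Riesz transform on $\mathbb{R}^2$, i.e., the Fourier multiplier with symbol $-i\xi_1/|\xi|$; thus $R_1^2$ is the Fourier multiplier with symbol $-\xi_1^2/|\xi|^2$, and $R_1^2$ denotes the composition of $R_1$ with itself. *)

(* Defs.v *)
From mathcomp Require Import all_boot all_order all_algebra.
From mathcomp Require Import all_classical all_reals all_analysis.
Set Implicit Arguments. Unset Strict Implicit. Unset Printing Implicit Defensive.
Import Order.TTheory GRing.Theory Num.Theory numFieldNormedType.Exports.
Local Open Scope classical_set_scope.
Local Open Scope ring_scope.

Definition leb2 (R : realType) :=
  (@lebesgue_measure R \x @lebesgue_measure R)%E.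
Arguments leb2 R : clear implicits.

Definition L1 (R : realType) (f : R * R -> R) : Prop :=
  measurable_fun setT f /\ (leb2 R).-integrable setT (EFin \o f).

Definition Lloc (R : realType) (f : R * R -> R) : Prop :=
  measurable_fun setT f /\
  forall r : R, (leb2 R).-integrable
     [set x | `|x.1| <= r /\ `|x.2| <= r] (EFin \o f).

Definition dotp (R : realType) (x y : R * R) : R := x.1 * y.1 + x.2 * y.2.

(* Fourier transform  \hat f(xi) = \int f(x) e^{-i x.xi} dx
   = ft_cos f xi - i * ft_sin f xi   (for real-valued f) *)
Definition ft_cos (R : realType) (f : R * R -> R) (xi : R * R) : R :=
  Rintegral (leb2 R) setT (fun x => f x * cos (dotp x xi)).
Definition ft_sin (R : realType) (f : R * R -> R) (xi : R * R) : R :=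
  Rintegral (leb2 R) setT (fun x => f x * sin (dotp x xi)).

(* symbol of R_1^2 : -xi_1^2/|xi|^2  (value 0 at xi = 0, a null set) *)
Definition R1sq_symbol (R : realType) (xi : R * R) : R :=
  - (xi.1 ^+ 2) / (xi.1 ^+ 2 + xi.2 ^+ 2).

Definition test_fun (R : realType) (phi : R * R -> R) : Prop :=
  continuous phi /\
  (exists r : R, forall x, ~ (`|x.1| <= r /\ `|x.2| <= r) -> phi x = 0) /\
  L1 (ft_cos phi) /\ L1 (ft_sin phi).

(* g is (a locally integrable representative of) R_1^2 f, for f in L^1,
   in the distributional sense: for every test function phi,
     \int g phi = (2 pi)^{-2} \int m(xi) \hat f(xi) \hat phi(-xi) dxi
   (Parseval), written out in real and imaginary parts, where
   \hat f(xi) = Cf - i Sf and \hat phi(-xi) = Cphi + i Sphi. *)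
Definition is_R1sq (R : realType) (f g : R * R -> R) : Prop :=
  Lloc g /\
  forall phi, test_fun phi ->
    Rintegral (leb2 R) setT (fun x => g x * phi x) =
      (4 * pi ^+ 2)^-1 * Rintegral (leb2 R) setT (fun xi =>
        R1sq_symbol xi * (ft_cos f xi * ft_cos phi xi
                          + ft_sin f xi * ft_sin phi xi)) /\
    0 = Rintegral (leb2 R) setT (fun xi =>
        R1sq_symbol xi * (ft_cos f xi * ft_sin phi xi
                          - ft_sin f xi * ft_cos phi xi)).

Definition ess_support (R : realType) (f : R * R -> R) : set (R * R) :=
  [set x | forall U : set (R * R), open U -> U x ->
     ~ {ae leb2 R, forall y, U y -> f y = 0}].

(* Main.v *)
(** The L^2 energy identity [int W * R_1^2 W = - int (xi_1/|xi|)^2 |FT W|^2 <= 0]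
    forces W to leave L^2, and indeed W concentrates at the origin almost like a
    Dirac mass.  Put bumps [w_k >= 0] of common mass 4 pi on disjoint discs of centre
    [(4^-k, 0)] and radius [4^-k / 4], with slowly decreasing weights [m_k].
    Outside its disc a radial bump acts like a point mass, so that [R_1^2 w_k] is
    [2 ((x_1 - a)^2 - x_2^2) / |x - (a,0)|^4], which is positive at all the other
    discs because they lie in a narrow cone around the x_1-axis.  On the j-th disc
    the bump itself contributes at least [- 96 m_j / a_j^2], while each of the next
    320 smaller discs contributes at least [(3/10) m_j / a_j^2].

    For a single bump w of radius r, the potential u of w and that of the bump of
    the same mass and of large radius n differ by a compactly supported C^2
    function v, for which the multiplier acts by [R_1^2 (- Lap v) = d_1^2 v]
    (integration by parts and Parseval); the contribution of the large bump tends
    to 0 as n grows.  Parseval is Fourier inversion for the test function, proved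
    by Abel summation with [exp (- e (|xi_1| + |xi_2|))], the transform of a
    product of two Poisson kernels.

    Real and imaginary parts of the Fourier identity are treated together through
    a phase c: c = 0 gives the former and c = pi/2 the latter. *)

From HB Require Import structures.
Require Import Defs.
From mathcomp Require Import all_boot all_order all_algebra.
From mathcomp Require Import all_classical all_reals all_analysis.
From mathcomp Require Import measurable_realfun ring lra.
Import Order.TTheory GRing.Theory Num.Theory numFieldNormedType.Exports.
Local Open Scope classical_set_scope.
Local Open Scope ring_scope.
Set Implicit Arguments. Unset Strict Implicit. Unset Printing Implicit Defensive.

(** * Integrals of real-valued functions *)

(** Scaling shapes the construction. On the j-th disc, at distance about [a_j] from the origin, the
    transform of a smaller disc is governed by its mass and hardly by its size or position. The
    negative self-term is therefore beaten by the number of smaller discs: many consecutive weights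
    must stay above [m_j / 2] while all weights remain summable, and a geometric sequence of ratio
    close to 1 does both. The constants come from the radius: the self-term [6 / r^2] with
    [r = a_j / 4] is [96 / a_j^2], a smaller disc of weight at least [m_j / 2] yields
    [3 / 5 / a_j^2] per unit of weight, and [96 / (3 / 10) = 320]. Larger discs only help, and their
    terms are dropped.

    Two obstacles remain. The potential of one bump is logarithmic, so integration by parts applies
    only to differences of potentials. The transform of a bump decays like [|x|^-2], which is not
    integrable at infinity in the plane; the transform of W is thus controlled only on bounded
    boxes, while W itself is summed globally. *)

Lemma integrable_dom d (T : measurableType d) (R : realType)
    (mu : {measure set T -> \bar R}) (D : set T) (f g : T -> R) :
  measurable D -> measurable_fun D f -> (forall x, D x -> `|f x| <= g x) ->
  mu.-integrable D (EFin \o g) -> mu.-integrable D (EFin \o f).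
Proof.
move=> mD mf fg; apply: le_integrable => //; first exact/measurable_EFinP.
move=> x Dx /=; rewrite lee_fin; apply: le_trans (fg x Dx) _; exact: ler_norm.
Qed.

Lemma integrableMr_bounded d (T : measurableType d) (R : realType)
    (mu : {measure set T -> \bar R}) (D : set T) (f b : T -> R) (M : R) :
  measurable D -> measurable_fun D b -> (forall x, D x -> `|b x| <= M) ->
  mu.-integrable D (EFin \o f) -> mu.-integrable D (EFin \o (fun x => f x * b x)).
Proof.
move=> mD mb bM fi; have mf : measurable_fun D f.
  by apply/measurable_EFinP; exact: measurable_int fi.
apply: (@integrable_dom _ _ _ _ _ _ (fun x => M * `|f x|)) => //.
- exact: measurable_funM.
- by move=> x Dx; rewrite normrM mulrC ler_wpM2r // bM.
- rewrite (_ : _ \o _ = (fun x => (M%:E * (`|f x|%R)%:E)%E)) //.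
  by apply: integrableZl => //; exact: integrable_norm fi.
Qed.

Lemma le_normr_Rintegral_dom d (T : measurableType d) (R : realType)
    (mu : {measure set T -> \bar R}) (D : set T) (f g : T -> R) :
  measurable D -> measurable_fun D f -> mu.-integrable D (EFin \o g) ->
  (forall x, D x -> `|f x| <= g x) ->
  `|Rintegral mu D f| <= Rintegral mu D g.
Proof.
move=> mD mf gi fg; have fi : mu.-integrable D (EFin \o f).
  exact: integrable_dom gi.
apply: (le_trans (le_normr_Rintegral mD fi)).
apply: le_Rintegral => //; first exact: integrable_norm fi.
Qed.

Lemma dominated_Rintegral d (T : measurableType d) (R : realType)
    (mu : {measure set T -> \bar R}) (D : set T) (f_ : nat -> T -> R)
    (f g : T -> R) :
  measurable D -> (forall n, measurable_fun D (f_ n)) -> measurable_fun D f ->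
  mu.-integrable D (EFin \o g) ->
  (forall n x, D x -> `|f_ n x| <= g x) ->
  {ae mu, forall x, D x -> f_ n x @[n --> \oo] --> f x} ->
  Rintegral mu D (f_ n) @[n --> \oo] --> Rintegral mu D f.
Proof.
move=> mD mf_ mf gi fg fcv.
have [||||fi _ cv] := @dominated_convergence _ _ _ mu D mD
  (fun n => EFin \o f_ n) (EFin \o f) (EFin \o g) _ _ _ gi _.
- by move=> n; exact/measurable_EFinP.
- exact/measurable_EFinP.
- apply: filterS fcv => x h Dx; apply: cvg_EFin; first exact: nearW.
  exact: h.
- by apply: aeW => x n Dx /=; rewrite lee_fin fg.
apply: fine_cvg; rewrite fineK; last exact: integrable_fin_num.
exact: cv.
Qed.

Lemma exists_rat_near (R : realType) (x e : R) : 0 < e ->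
  exists q : rat, `|x - ratr q| < e.
Proof.
move=> e0; have : x - e < x + e by rewrite ltrD2l gtrN.
move=> /rat_in_itvoo[q]; rewrite in_itv /= => /andP[h1 h2].
by exists q; rewrite distrC ltr_distl h1.
Qed.

(** Measurable sets of [R * R] are generated by rectangles, so measurability of open sets needs an
    argument: an open set is the countable union of the boxes it contains with rational centres and
    radii [1 / (n + 1)]. Boxes that are not contained are replaced by [set0] to keep a countable
    index type. *)
Lemma open_measurable_prod (R : realType) (U : set (R * R)) :
  open U -> measurable U.
Proof.
move=> oU.
pose box (i : rat * rat * nat) : set (R * R) :=
  ball (ratr i.1.1 : R) (i.2.+1%:R^-1) `*` ball (ratr i.1.2 : R) (i.2.+1%:R^-1).
pose B i : set (R * R) := if `[< box i `<=` U >] then box i else set0.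
have -> : U = \bigcup_i B i.
  apply/seteqP; split => [x Ux|x [i _]]; last first.
    by rewrite /B; case: asboolP => // h /h.
  have : nbhs x U by exact: open_nbhs_nbhs.
  move=> /nbhs_ballP[e /= e0 xeU].
  have e20 : 0 < e / 2 by rewrite divr_gt0.
  have [N _ /(_ N (leqnn _)) /= hN] := near_infty_natSinv_lt (PosNum e20).
  have i0 : 0 < N.+1%:R^-1 :> R by rewrite invr_gt0 ltr0n.
  have [q1 hq1] := exists_rat_near x.1 i0.
  have [q2 hq2] := exists_rat_near x.2 i0.
  exists (q1, q2, N) => //; rewrite /B asboolT.
    by split => /=; rewrite -ball_normE /= distrC.
  move=> y [/=]; rewrite -!ball_normE /= => y1 y2; apply: xeU; split => /=;
    rewrite -ball_normE /=.
  - rewrite -(subrK (ratr q1) x.1) -addrA (le_lt_trans (ler_normD _ _)) //.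
    by rewrite [ltRHS]splitr ltrD // (lt_trans _ hN).
  - rewrite -(subrK (ratr q2) x.2) -addrA (le_lt_trans (ler_normD _ _)) //.
    by rewrite [ltRHS]splitr ltrD // (lt_trans _ hN).
apply: countable_bigcupT_measurable => // i; rewrite /B; case: asboolP => // _.
by apply: measurableX; exact: measurable_ball.
Qed.

Lemma continuous_measurable_fun2 (R : realType) (f : R * R -> R) :
  continuous f -> measurable_fun setT f.
Proof.
move=> cf; apply: (measurability _ (RGenOInfty.measurableE R)).
move=> /= _ [_ [a ->]] <-; apply: measurableI => //.
apply: open_measurable_prod; apply: open_comp; last exact: interval_open.
by move=> x _; exact: cf.
Qed.

(** * Improper integrals by the fundamental theorem of calculus *)

Lemma integral_FTC (R : realType) (f F : R -> R) (a b : R) :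
  a < b -> continuous f -> (forall x : R, is_derive x (1 : R) F (f x)) ->
  (\int[@lebesgue_measure R]_(x in `[a, b]) (f x)%:E)%E = (F b - F a)%:E.
Proof.
move=> ab cf dF; have cF : continuous F.
  move=> x; apply: differentiable_continuous; apply/derivable1_diffP.
  by have [] := dF x.
rewrite (@continuous_FTC2 _ f F) ?EFinB //.
- exact: continuous_subspaceT.
- split.
  + by move=> x _; have [] := dF x.
  + exact/cvg_at_right_filter/cF.
  + exact/cvg_at_left_filter/cF.
- by move=> x _; rewrite derive1E; have [_ ->] := dF x.
Qed.

Lemma bigcup_itv_nat (R : realType) :
  \bigcup_n (`[- n.+1%:R, n.+1%:R]%classic : set R) = [set: R].
Proof.
apply/seteqP; split => // x _; exists (Num.truncn `|x|) => //=.
rewrite in_itv /= -ler_norml; exact/ltW/truncnS_gt.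
Qed.

Lemma nondecreasing_itv_nat (R : realType) :
  nondecreasing_seq (fun n : nat => `[- n.+1%:R, n.+1%:R]%classic : set R).
Proof.
move=> m n mn; apply/subsetPset => x /=; rewrite !in_itv /= -!ler_norml => h.
by rewrite (le_trans h) // ler_nat ltnS.
Qed.

(** For a nonnegative integrand monotone convergence gives the value without assuming integrability,
    which is then a consequence; the signed version below assumes integrability and uses dominated
    convergence. *)
Lemma improper_FTC_ge0 (R : realType) (f F : R -> R) (l : R) :
  (forall x, 0 <= f x) -> continuous f ->
  (forall x : R, is_derive x (1 : R) F (f x)) ->
  F n.+1%:R - F (- n.+1%:R) @[n --> \oo] --> l ->
  (\int[@lebesgue_measure R]_x (f x)%:E)%E = l%:E.
Proof.
move=> f0 cf dF cvF.
have mf : measurable_fun setT f by exact: continuous_measurable_fun.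
have := @ge0_nondecreasing_set_cvg_integral _ (measurableTypeR R) R
  (fun n => `[- n.+1%:R, n.+1%:R]%classic : set R) (EFin \o f)
  (@lebesgue_measure R) (@nondecreasing_itv_nat R).
rewrite bigcup_itv_nat => /(_ _ _ _) h.
have h1 := h (fun=> measurable_itv _) _ _.
apply: (cvg_unique (@ereal_hausdorff R) (h1 _ _)).
- by move=> i; apply/measurable_EFinP; exact: measurable_funS mf.
- by move=> i x _; rewrite lee_fin.
apply: cvg_trans (_ : EFin (F n.+1%:R - F (- n.+1%:R)) @[n --> \oo] --> l%:E).
  apply: near_eq_cvg; apply: nearW => n /=.
  by rewrite (@integral_FTC _ _ F) ?gtrN ?ltr0Sn.
by apply: cvg_EFin; [exact: nearW|exact: cvF].
Qed.

Lemma improper_FTC (R : realType) (f F : R -> R) (l : R) :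
  (@lebesgue_measure R).-integrable setT (EFin \o f) -> continuous f ->
  (forall x : R, is_derive x (1 : R) F (f x)) ->
  F n.+1%:R - F (- n.+1%:R) @[n --> \oo] --> l ->
  Rintegral (@lebesgue_measure R) setT f = l.
Proof.
move=> fi cf dF cvF.
have mf : measurable_fun setT f by exact: continuous_measurable_fun.
have E n : F n.+1%:R - F (- n.+1%:R) =
    Rintegral (@lebesgue_measure R) setT (f \_ `[- n.+1%:R, n.+1%:R]).
  rewrite -Rintegral_mkcond /Rintegral.
  by rewrite (@integral_FTC _ _ F) // ?gtrN ?ltr0Sn //.
move: cvF; under eq_fun do rewrite E; move=> cvF.
apply: (cvg_unique (@Rhausdorff R) _ cvF).
apply: (@dominated_Rintegral _ (measurableTypeR R) R (@lebesgue_measure R) _ _ _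
  (fun x => `|f x|)) => //.
- move=> n; apply/(measurable_restrictT _ _).1 => //.
  exact: measurable_funS mf.
- exact: integrable_norm.
- by move=> n x _; rewrite patchE; case: ifP => // _; rewrite normr0.
- apply: aeW => x _; apply: cvg_near_cst.
  exists (Num.truncn `|x|) => // n /= nx; rewrite patchE mem_set //=.
  rewrite in_itv /= -ler_norml; apply: (le_trans (ltW (truncnS_gt _))).
  by rewrite ler_nat ltnS.
Qed.

(** * Fubini for tensor products and bounded kernels *)

Lemma integrable_tensor d1 d2 (T1 : measurableType d1) (T2 : measurableType d2)
    (R : realType) (m1 : {sigma_finite_measure set T1 -> \bar R})
    (m2 : {sigma_finite_measure set T2 -> \bar R}) (f : T1 -> R) (g : T2 -> R) :
  m1.-integrable setT (EFin \o f) -> m2.-integrable setT (EFin \o g) ->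
  (m1 \x m2)%E.-integrable setT (EFin \o (fun z => f z.1 * g z.2)).
Proof.
move=> fi gi.
have mf : measurable_fun setT f by exact/measurable_EFinP/(measurable_int _ fi).
have mg : measurable_fun setT g by exact/measurable_EFinP/(measurable_int _ gi).
apply/integrable12ltyP.
  apply/measurable_EFinP; apply: measurable_funM.
  - exact: measurableT_comp mf measurable_fst.
  - exact: measurableT_comp mg measurable_snd.
have -> : (fun x => \int[m2]_y `|(EFin \o (fun z : T1 * T2 => f z.1 * g z.2)%R) (x, y)|)%E =
   (fun x => (`|f x|)%:E * \int[m2]_y `|(EFin \o g) y|)%E.
  apply/funext => x; rewrite -ge0_integralZl //.
  - by apply: eq_integral => y _ /=; rewrite normrM EFinM.
  - by apply: measurableT_comp => //; exact/measurable_EFinP.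
have -> : (\int[m1]_x ((`|f x|)%:E * \int[m2]_y `|(EFin \o g) y|))%E =
    ((\int[m1]_x `|(EFin \o f) x|) * \int[m2]_y `|(EFin \o g) y|)%E.
  apply: ge0_integralZr => //; last exact: integral_ge0.
  by apply/measurable_EFinP; exact: measurableT_comp.
move/integrableP : fi => [_ fi]; move/integrableP : gi => [_ gi].
apply: lte_mul_pinfty => //; first exact: integral_ge0.
by rewrite ge0_fin_numE //; exact: integral_ge0.
Qed.

Lemma Rintegral_prod12 d1 d2 (T1 : measurableType d1) (T2 : measurableType d2)
    (R : realType) (m1 : {sigma_finite_measure set T1 -> \bar R})
    (m2 : {sigma_finite_measure set T2 -> \bar R}) (h : T1 * T2 -> R) :
  (m1 \x m2)%E.-integrable setT (EFin \o h) ->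
  Rintegral (m1 \x m2)%E setT h =
  Rintegral m1 setT (fun x => Rintegral m2 setT (fun y => h (x, y))).
Proof.
move=> hi; rewrite /Rintegral -integral12_prod_meas1 //; congr fine.
have mF := measurable_fubini_F hi.
apply: ae_eq_integral => //.
  apply/measurable_EFinP; apply: measurableT_comp => //; exact: mF.
apply: filterS (ae_integrable1 hi) => x xi _ /=.
by rewrite fineK //; exact: integrable_fin_num.
Qed.

Lemma Rintegral_prod21 d1 d2 (T1 : measurableType d1) (T2 : measurableType d2)
    (R : realType) (m1 : {sigma_finite_measure set T1 -> \bar R})
    (m2 : {sigma_finite_measure set T2 -> \bar R}) (h : T1 * T2 -> R) :
  (m1 \x m2)%E.-integrable setT (EFin \o h) ->
  Rintegral (m1 \x m2)%E setT h =
  Rintegral m2 setT (fun y => Rintegral m1 setT (fun x => h (x, y))).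
Proof.
move=> hi; rewrite /Rintegral -integral21_prod_meas1 //; congr fine.
have mF := measurable_fubini_G hi.
apply: ae_eq_integral => //.
  apply/measurable_EFinP; apply: measurableT_comp => //; exact: mF.
apply: filterS (ae_integrable2 hi) => x xi _ /=.
by rewrite fineK //; exact: integrable_fin_num.
Qed.

Lemma Rintegral_tensor d1 d2 (T1 : measurableType d1) (T2 : measurableType d2)
    (R : realType) (m1 : {sigma_finite_measure set T1 -> \bar R})
    (m2 : {sigma_finite_measure set T2 -> \bar R}) (f : T1 -> R) (g : T2 -> R) :
  m1.-integrable setT (EFin \o f) -> m2.-integrable setT (EFin \o g) ->
  Rintegral (m1 \x m2)%E setT (fun z => f z.1 * g z.2) =
  Rintegral m1 setT f * Rintegral m2 setT g.
Proof.
move=> fi gi; rewrite Rintegral_prod12; last exact: integrable_tensor.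
rewrite -RintegralZr //; apply: eq_Rintegral => x _ /=; exact: RintegralZl.
Qed.

Lemma integrable_kernel d1 d2 (T1 : measurableType d1) (T2 : measurableType d2)
    (R : realType) (m1 : {sigma_finite_measure set T1 -> \bar R})
    (m2 : {sigma_finite_measure set T2 -> \bar R}) (f : T1 -> R) (g : T2 -> R)
    (K : T1 * T2 -> R) :
  m1.-integrable setT (EFin \o f) -> m2.-integrable setT (EFin \o g) ->
  measurable_fun setT K -> (forall z, `|K z| <= 1) ->
  (m1 \x m2)%E.-integrable setT (EFin \o (fun z => f z.1 * g z.2 * K z)).
Proof.
move=> fi gi mK K1; apply: (@integrableMr_bounded _ _ _ _ _ _ _ 1) => //.
exact: integrable_tensor.
Qed.

Lemma measurable_Rintegral_kernel d1 d2 (T1 : measurableType d1)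
    (T2 : measurableType d2) (R : realType)
    (m2 : {sigma_finite_measure set T2 -> \bar R}) (g : T2 -> R)
    (K : T1 * T2 -> R) :
  m2.-integrable setT (EFin \o g) ->
  measurable_fun setT K -> (forall z, `|K z| <= 1) ->
  measurable_fun setT (fun x => Rintegral m2 setT (fun y => g y * K (x, y))).
Proof.
move=> gi mK K1.
have mg : measurable_fun setT g by exact/measurable_EFinP/(measurable_int _ gi).
pose h z := g z.2 * K z.
have mh : measurable_fun setT (EFin \o h).
  apply/measurable_EFinP; apply: measurable_funM => //.
  exact: measurableT_comp mg measurable_snd.
apply: measurableT_comp => //.
under eq_fun => x do rewrite integralE.
apply: emeasurable_funB.
- have mp := measurable_funepos mh.
  have := @measurable_fun_fubini_tonelli_F _ _ _ _ R m2 _ mp (funepos_ge0 _).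
  by congr measurable_fun; apply/funext => x; rewrite /fubini_F;
    apply: eq_integral => y _; rewrite !funeposE.
- have mp := measurable_funeneg mh.
  have := @measurable_fun_fubini_tonelli_F _ _ _ _ R m2 _ mp (funeneg_ge0 _).
  by congr measurable_fun; apply/funext => x; rewrite /fubini_F;
    apply: eq_integral => y _; rewrite !funenegE.
Qed.

(** The exchanges of space and frequency integrals below all have this form, with [K] a cosine wave:
    integrability of the two factors and boundedness of the kernel suffice for Fubini. *)
Lemma Rintegral_kernel_swap d1 d2 (T1 : measurableType d1) (T2 : measurableType d2)
    (R : realType) (m1 : {sigma_finite_measure set T1 -> \bar R})
    (m2 : {sigma_finite_measure set T2 -> \bar R}) (f : T1 -> R) (g : T2 -> R)
    (K : T1 * T2 -> R) :
  m1.-integrable setT (EFin \o f) -> m2.-integrable setT (EFin \o g) ->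
  measurable_fun setT K -> (forall z, `|K z| <= 1) ->
  Rintegral m2 setT (fun y => g y * Rintegral m1 setT (fun x => f x * K (x, y))) =
  Rintegral m1 setT (fun x => f x * Rintegral m2 setT (fun y => g y * K (x, y))).
Proof.
move=> fi gi mK K1; have hi := integrable_kernel fi gi mK K1.
transitivity (Rintegral (m1 \x m2)%E setT (fun z => f z.1 * g z.2 * K z)).
- rewrite Rintegral_prod21 //; apply: eq_Rintegral => y _.
  rewrite -RintegralZl //; last first.
    apply: (@integrableMr_bounded _ _ _ _ _ _ _ 1) => //.
    exact: measurableT_comp mK (pair2_measurable y).
  by apply: eq_Rintegral => x _ /=; rewrite mulrA (mulrC (g y)).
- rewrite Rintegral_prod12 //; apply: eq_Rintegral => x _.
  rewrite -RintegralZl //; last first.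
    apply: (@integrableMr_bounded _ _ _ _ _ _ _ 1) => //.
    exact: measurableT_comp mK (pair1_measurable x).
  by apply: eq_Rintegral => y _ /=; rewrite mulrA.
Qed.

(** * Abel summation and the Poisson kernel *)

(** Away from [a] the glued function is locally one of the two. At [a] each of its difference
    quotients is one of [f] or one of [g], and both families converge to [df a]. *)
Lemma is_derive_glue (R : realType) (f g df dg : R -> R) (a : R) :
  (forall x : R, x <= a -> is_derive x (1 : R) f (df x)) ->
  (forall x : R, a <= x -> is_derive x (1 : R) g (dg x)) ->
  f a = g a -> df a = dg a ->
  forall x : R, is_derive x (1 : R) (fun y => if y <= a then f y else g y)
    (if x <= a then df x else dg x).
Proof.
move=> Df Dg fga dfga x; case: (ltgtP x a) => [xa|ax|->].
- apply: near_eq_is_derive (Df _ (ltW xa)); near=> y.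
  by rewrite ifT //; apply: ltW; near: y; exact: lt_nbhsl.
- apply: near_eq_is_derive (Dg _ (ltW ax)); near=> y.
  by rewrite ifF //; apply/negbTE; rewrite -ltNge; near: y; exact: lt_nbhsr.
- have cf : h^-1 *: (f (h *: 1 + a) - f a) @[h --> (0 : R)^'] --> df a.
    by have [+ <-] := Df a (lexx _); exact.
  have cg : h^-1 *: (g (h *: 1 + a) - g a) @[h --> (0 : R)^'] --> df a.
    by rewrite dfga; have [+ <-] := Dg a (lexx _); exact.
  set k := fun y => _.
  have ck : h^-1 *: (k (h *: 1 + a) - k a) @[h --> (0 : R)^'] --> df a.
    move=> P /= hP.
    have h1 : \forall h \near (0 : R)^', P (h^-1 *: (f (h *: 1 + a) - f a)).
      exact: cf hP.
    have h2 : \forall h \near (0 : R)^', P (h^-1 *: (g (h *: 1 + a) - g a)).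
      exact: cg hP.
    change (\forall h \near (0 : R)^', P (h^-1 *: (k (h *: 1 + a) - k a))).
    near=> h; rewrite /k lexx; case: ifP => _; first by near: h.
    by rewrite fga; near: h.
  split; first by apply/cvg_ex; exists (df a).
  exact/cvg_lim.
Unshelve. all: by end_near. Qed.

Lemma continuous_glue (R : realType) (f g : R -> R) (a : R) :
  (forall x, x <= a -> {for x, continuous f}) ->
  (forall x, a <= x -> {for x, continuous g}) -> f a = g a ->
  continuous (fun y => if y <= a then f y else g y).
Proof.
move=> cf cg fga x.
have [xa|ax|->] := ltgtP x a.
- rewrite /continuous_at ifT ?(ltW xa) //; apply: cvg_trans (cf x (ltW xa)).
  apply: near_eq_cvg; near=> y.
  by rewrite ifT //; apply: ltW; near: y; exact: lt_nbhsl.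
- rewrite /continuous_at ifF ?(lt_geF ax) //; apply: cvg_trans (cg x (ltW ax)).
  apply: near_eq_cvg; near=> y.
  by rewrite ifF //; apply/negbTE; rewrite -ltNge; near: y; exact: lt_nbhsr.
- rewrite /continuous_at lexx => P hP.
  have h1 : \forall y \near a, P (f y) by exact: (cf a (lexx _)) hP.
  have h2 : \forall y \near a, P (g y) by apply: (cg a (lexx _)); rewrite -fga.
  change (\forall y \near a, P (if y <= a then f y else g y)).
  by near=> y; case: ifP => _; near: y.
Unshelve. all: by end_near. Qed.

(** Not normalised: the total mass is [2 * pi], which makes it exactly the Fourier transform of
    [abel_ker e]. *)
Definition poisson_ker (R : realType) (e z : R) : R := 2 * e / (e ^+ 2 + z ^+ 2).
Definition abel_ker (R : realType) (e t : R) : R := expR (- (e * `|t|)).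

Lemma continuous_abel_ker (R : realType) (e : R) : continuous (abel_ker e).
Proof.
move=> x; apply: continuous_comp; last exact: continuous_expR.
apply: continuousN; apply: continuousM; first exact: cst_continuous.
exact: norm_continuous.
Qed.

(** On each half-line this is the real part of the primitive of [exp (- e |x| + i (z x + c))]; the
    constant [2 * e * cos c / D] glues the two halves at 0. *)
Definition abel_antideriv (R : realType) (e z c x : R) : R :=
  let D := e ^+ 2 + z ^+ 2 in
  if x <= 0
  then expR (e * x) * (z * sin (z * x + c) + e * cos (z * x + c)) / D
  else expR (- e * x) * (z * sin (z * x + c) - e * cos (z * x + c)) / D
       + 2 * e * cos c / D.

Lemma is_derive_abel_antideriv (R : realType) (e z c : R) : 0 < e ->
  forall x : R, is_derive x (1 : R) (abel_antideriv e z c)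
    (abel_ker e x * cos (z * x + c)).
Proof.
move=> e0 x; pose D := e ^+ 2 + z ^+ 2.
have D0 : D != 0 by rewrite gt_eqF // ltr_pwDl ?exprn_gt0 ?sqr_ge0.
have -> : abel_ker e x * cos (z * x + c) =
  if x <= 0 then expR (e * x) * cos (z * x + c) else expR (- e * x) * cos (z * x + c).
  rewrite /abel_ker; case: ltgtP => [x0|x0|->]; rewrite ?(ltr0_norm x0) ?(gtr0_norm x0) ?normr0 //.
  - by rewrite mulrN opprK.
  - by rewrite mulNr.
  - by rewrite !mulr0 oppr0.
apply: (@is_derive_glue _ _ _ (fun x => expR (e * x) * cos (z * x + c))
  (fun x => expR (- e * x) * cos (z * x + c))).
- move=> y _; apply: is_derive_eq; rewrite /GRing.scale /= ; apply: (mulIf D0).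
  rewrite /D in D0 *; by field.
- move=> y _; apply: is_derive_eq; rewrite /GRing.scale /= ; apply: (mulIf D0).
  rewrite /D in D0 *; by field.
- by rewrite !mulr0 expR0 add0r; rewrite /D in D0 *; field.
- by rewrite !mulr0.
Qed.

Lemma cvg_of_harmonic_bound (R : realType) (u : nat -> R) (l C : R) :
  (forall n, `|u n - l| <= C * n.+1%:R^-1) -> u n @[n --> \oo] --> l.
Proof.
move=> h; apply/cvgrPdist_lt => e e0.
have Ce0 : 0 < e / (`|C| + 1) by rewrite divr_gt0 // ltr_wpDl.
have [N _ hN] := near_infty_natSinv_lt (PosNum Ce0).
exists N => // n /= Nn; rewrite distrC (le_lt_trans (h n)) //.
apply: (@le_lt_trans _ _ ((`|C| + 1) * n.+1%:R^-1)).
  by rewrite ler_wpM2r // (le_trans (ler_norm _)) // lerDl.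
by rewrite mulrC -ltr_pdivlMr ?hN // ltr_wpDl.
Qed.

Lemma expRN_le_inv (R : realType) (t : R) : 0 < t -> expR (- t) <= t^-1.
Proof.
move=> t0; rewrite expRN lef_pV2 ?posrE ?expR_gt0 //.
by apply: le_trans (expR_ge1Dx t); rewrite lerDr.
Qed.

(** The exponential terms are [O(1 / n)], and what survives is the gluing constant. *)
Lemma cvg_abel_antideriv (R : realType) (e z c : R) : 0 < e ->
  abel_antideriv e z c n.+1%:R - abel_antideriv e z c (- n.+1%:R) @[n --> \oo]
  --> cos c * poisson_ker e z.
Proof.
move=> e0; pose D := e ^+ 2 + z ^+ 2.
have D0 : 0 < D by rewrite ltr_pwDl ?exprn_gt0 ?sqr_ge0.
apply: (@cvg_of_harmonic_bound _ _ _ (2 * ((`|z| + e) / D) / e)) => n.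
have n0 : 0 < n.+1%:R :> R by rewrite ltr0n.
have n0N : - n.+1%:R <= 0 :> R by rewrite oppr_le0 ltW.
rewrite /abel_antideriv -/D (lt_geF n0) n0N mulrN -mulNr.
set E := expR _; set X := z * sin _ - _; set Y := z * sin _ + _.
have E1 : 0 <= E <= e^-1 * n.+1%:R^-1.
  rewrite expR_ge0 /= /E mulNr -invfM mulrC; apply: expRN_le_inv.
  exact: mulr_gt0.
have hX : `|X| <= `|z| + e.
  rewrite (le_trans (ler_normB _ _)) // !normrM lerD //.
    by rewrite ler_piMr // sin_max.
  by rewrite (gtr0_norm e0) ler_piMr ?cos_max // ltW.
have hY : `|Y| <= `|z| + e.
  rewrite (le_trans (ler_normD _ _)) // !normrM lerD //.
    by rewrite ler_piMr // sin_max.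
  by rewrite (gtr0_norm e0) ler_piMr ?cos_max // ltW.
rewrite /poisson_ker -/D [cos c * _]mulrA [cos c * _]mulrC addrAC addrK.
rewrite -mulrBl -mulrBr normrM normrM ger0_norm; last by case/andP: E1.
rewrite (gtr0_norm (_ : 0 < D^-1)) ?invr_gt0 //.
case/andP: E1 => E0 E1.
have -> : 2 * ((`|z| + e) / D) / e / n.+1%:R =
  (e^-1 * n.+1%:R^-1) * ((`|z| + e) + (`|z| + e)) / D.
  by field; rewrite !gt_eqF.
apply: ler_wpM2r; first by rewrite invr_ge0 ltW.
apply: ler_pM => //; rewrite (le_trans (ler_normB _ _)) // lerD //.
Qed.

Lemma integral_abel_ker (R : realType) (e : R) : 0 < e ->
  (\int[@lebesgue_measure R]_x (abel_ker e x)%:E)%E = (2 / e)%:E.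
Proof.
move=> e0; pose F := abel_antideriv e 0 0.
apply: (@improper_FTC_ge0 _ (abel_ker e) F).
- by move=> x; exact: expR_ge0.
- exact: continuous_abel_ker.
- move=> x; have := is_derive_abel_antideriv 0 0 e0 x.
  by rewrite mul0r addr0 cos0 mulr1.
- have -> : 2 / e = cos 0 * poisson_ker e 0.
    by rewrite /poisson_ker cos0 expr0n addr0; field; rewrite gt_eqF.
  exact: cvg_abel_antideriv.
Qed.

Lemma integrable_of_ge0_integral (R : realType) d (T : measurableType d)
    (m : {measure set T -> \bar R}) (f : T -> R) (l : R) :
  measurable_fun setT f -> (forall x, 0 <= f x) ->
  (\int[m]_x (f x)%:E)%E = l%:E -> m.-integrable setT (EFin \o f).
Proof.
move=> mf f0 fl; apply/integrableP; split; first exact/measurable_EFinP.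
rewrite (_ : (\int[m]_x _)%E = l%:E) ?ltry // -fl.
by apply: eq_integral => x _ /=; rewrite ger0_norm.
Qed.

Lemma integrable_abel_ker (R : realType) (e : R) : 0 < e ->
  (@lebesgue_measure R).-integrable setT (EFin \o abel_ker e).
Proof.
move=> e0; apply: integrable_of_ge0_integral (integral_abel_ker e0).
- by apply: continuous_measurable_fun; exact: continuous_abel_ker.
- by move=> x; exact: expR_ge0.
Qed.

Lemma continuous_cos_affine (R : realType) (z c : R) :
  continuous (fun t : R => cos (z * t + c)).
Proof.
move=> x; apply: continuous_comp; last exact: continuous_cos.
apply: continuousD; last exact: cst_continuous.
by apply: continuousM; [exact: cst_continuous|exact: id].
Qed.

Lemma Rintegral_abel_cos (R : realType) (e z c : R) : 0 < e ->
  Rintegral (@lebesgue_measure R) setT (fun t => abel_ker e t * cos (z * t + c))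
  = cos c * poisson_ker e z.
Proof.
move=> e0; apply: (@improper_FTC _ _ (abel_antideriv e z c)).
- apply: (@integrableMr_bounded _ (measurableTypeR R) _ _ _ _ _ 1) => //.
  + by apply: continuous_measurable_fun; exact: continuous_cos_affine.
  + by move=> x _; exact: cos_max.
  + exact: integrable_abel_ker.
- move=> x; apply: continuousM; first exact: continuous_abel_ker.
  exact: continuous_cos_affine.
- by move=> x; exact: is_derive_abel_antideriv.
- exact: cvg_abel_antideriv.
Qed.

Lemma poisson_ker_ge0 (R : realType) (e z : R) : 0 < e -> 0 <= poisson_ker e z.
Proof.
by move=> e0; rewrite divr_ge0 ?mulr_ge0 ?addr_ge0 ?sqr_ge0 ?ltW.
Qed.

Lemma continuous_poisson_ker (R : realType) (e y : R) : 0 < e ->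
  continuous (fun x => poisson_ker e (x - y)).
Proof.
move=> e0 x; apply: cvgMr; apply: cvgV.
  by rewrite gt_eqF // ltr_pwDl ?exprn_gt0 ?sqr_ge0.
apply: cvgD; first exact: cvg_cst.
apply: (@cvg_comp _ _ _ (fun x => x - y) (fun x => x ^+ 2)); last exact: exprn_continuous.
by apply: cvgB; [exact: cvg_id|exact: cvg_cst].
Qed.

Lemma is_derive_poisson_antideriv (R : realType) (e y : R) : 0 < e ->
  forall x : R, is_derive x (1 : R) (fun x => 2 * atan ((x - y) / e))
    (poisson_ker e (x - y)).
Proof.
move=> e0 x; apply: is_derive_eq; rewrite /poisson_ker /GRing.scale /=.
have E0 : e != 0 by rewrite gt_eqF.
have D0 : 1 + ((x - y) / e) ^+ 2 != 0 by rewrite gt_eqF // ltr_pwDl ?sqr_ge0.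
have D1 : e ^+ 2 + (x - y) ^+ 2 != 0.
  by rewrite gt_eqF // ltr_pwDl ?exprn_gt0 ?sqr_ge0.
by field; rewrite D1 E0.
Qed.

Lemma cvg_shift_scale_y (R : realType) (e y : R) : 0 < e ->
  (n.+1%:R - y) / e @[n --> \oo] --> +oo.
Proof.
move=> e0; apply/cvgryPge => A.
exists (Num.truncn `|A * e + y|) => // n /= h.
rewrite ler_pdivlMr // lerBrDr (le_trans (ler_norm _)) //.
by rewrite (le_trans (ltW (truncnS_gt _))) // ler_nat ltnS.
Qed.

Lemma integral_poisson_ker (R : realType) (e y : R) : 0 < e ->
  (\int[@lebesgue_measure R]_x (poisson_ker e (x - y))%:E)%E = (2 * pi)%:E.
Proof.
move=> e0.
apply: (@improper_FTC_ge0 _ (fun x => poisson_ker e (x - y))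
  (fun x => 2 * atan ((x - y) / e))).
- by move=> x; exact: poisson_ker_ge0.
- exact: continuous_poisson_ker.
- exact: is_derive_poisson_antideriv.
have -> : 2 * pi = 2 * (pi / 2) - (2 * - (pi / 2)) :> R by field.
apply: cvgB; apply: cvgMr.
- by apply: (cvg_comp _ _ (cvg_shift_scale_y y e0)); exact: cvgy_atan.
- rewrite (_ : (fun n => _) = fun n => - atan ((n.+1%:R - (- y)) / e)).
    apply: cvgN.
    by apply: (cvg_comp _ _ (cvg_shift_scale_y (- y) e0)); exact: cvgy_atan.
  by apply/funext => n; rewrite -atanN; congr atan; rewrite -mulNr opprB addrC.
Qed.

Lemma integrable_poisson_ker (R : realType) (e y : R) : 0 < e ->
  (@lebesgue_measure R).-integrable setT (EFin \o (fun x => poisson_ker e (x - y))).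
Proof.
move=> e0; apply: integrable_of_ge0_integral (integral_poisson_ker y e0).
- by apply: continuous_measurable_fun; exact: continuous_poisson_ker.
- by move=> x; exact: poisson_ker_ge0.
Qed.

Lemma Rintegral_poisson_ker (R : realType) (e y : R) : 0 < e ->
  Rintegral (@lebesgue_measure R) setT (fun x => poisson_ker e (x - y)) = 2 * pi.
Proof. by move=> e0; rewrite /Rintegral integral_poisson_ker. Qed.

Lemma measurable_cos_dotp (R : realType) (c : R) :
  measurable_fun setT (fun z : (R * R) * (R * R) => cos (dotp z.1 z.2 + c)).
Proof.
apply: (@measurableT_comp _ _ _ _ _ _ (@cos R)).
  by apply: continuous_measurable_fun; exact: continuous_cos.
apply: measurable_funD => //; apply: measurable_funD; apply: measurable_funM.
- exact: measurableT_comp measurable_fst measurable_fst.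
- exact: measurableT_comp measurable_fst measurable_snd.
- exact: measurableT_comp measurable_snd measurable_fst.
- exact: measurableT_comp measurable_snd measurable_snd.
Qed.

Lemma measurable_cos_dotpr (R : realType) (c : R) (x : R * R) :
  measurable_fun setT (fun xi : R * R => cos (dotp x xi + c)).
Proof.
exact: (measurableT_comp (measurable_cos_dotp c) (pair1_measurable x)).
Qed.

Lemma measurable_cos_dotpl (R : realType) (c : R) (xi : R * R) :
  measurable_fun setT (fun x : R * R => cos (dotp x xi + c)).
Proof.
exact: (measurableT_comp (measurable_cos_dotp c) (pair2_measurable xi)).
Qed.

Lemma integrable_abel_ker2 (R : realType) (e : R) : 0 < e ->
  (leb2 R).-integrable setT (EFin \o (fun xi => abel_ker e xi.1 * abel_ker e xi.2)).
Proof. by move=> e0; apply: integrable_tensor; exact: integrable_abel_ker. Qed.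

Lemma Rintegral_abel_cos2 (R : realType) (e c : R) (z : R * R) : 0 < e ->
  Rintegral (leb2 R) setT (fun xi =>
    abel_ker e xi.1 * abel_ker e xi.2 * cos (dotp z xi + c))
  = cos c * (poisson_ker e z.1 * poisson_ker e z.2).
Proof.
move=> e0; rewrite Rintegral_prod12; last first.
  apply: (@integrableMr_bounded _ _ _ _ _ _ _ 1) => //.
  - exact: measurable_cos_dotpr.
  - by move=> x _; exact: cos_max.
  - exact: integrable_abel_ker2.
rewrite mulrA -Rintegral_abel_cos // -RintegralZr //; last first.
  apply: (@integrableMr_bounded _ (measurableTypeR R) _ _ _ _ _ 1) => //.
  + by apply: continuous_measurable_fun; exact: continuous_cos_affine.
  + by move=> x _; exact: cos_max.
  + exact: integrable_abel_ker.
apply: eq_Rintegral => x _ /=.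
rewrite -[RHS]mulrA -Rintegral_abel_cos // -RintegralZl //; last first.
  apply: (@integrableMr_bounded _ (measurableTypeR R) _ _ _ _ _ 1) => //.
  + by apply: continuous_measurable_fun; exact: continuous_cos_affine.
  + by move=> y _; exact: cos_max.
  + exact: integrable_abel_ker.
by apply: eq_Rintegral => y _; rewrite /dotp /= mulrA addrCA addrA.
Qed.

Lemma sin_cosBpihalf (R : realType) (a : R) : sin a = cos (a - pi / 2).
Proof. by rewrite cosB cos_pihalf sin_pihalf mulr0 mulr1 add0r. Qed.

(** At distance at least [r] the kernel is at most [O(e)] times the kernel of parameter 1. Comparing
    with another Poisson kernel lets tails be integrated through the known total mass. *)
Lemma poisson_ker_tail (R : realType) (e r z : R) : 0 < e -> 0 < r -> r <= `|z| ->
  poisson_ker e z <= e * (1 + r ^- 2) * poisson_ker 1 z.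
Proof.
move=> e0 r0 rz; rewrite /poisson_ker mulr1 expr1n.
have z2 : r ^+ 2 <= z ^+ 2 by rewrite -[z ^+ 2]real_normK ?num_real // lerXn2r ?nnegrE // ltW.
have r2 : 0 < r ^+ 2 by rewrite exprn_gt0.
have e2 : 0 < e ^+ 2 by rewrite exprn_gt0.
have z20 := sqr_ge0 z.
have d1 : 0 < e ^+ 2 + z ^+ 2 by lra.
have d2 : 0 < 1 + z ^+ 2 by lra.
rewrite mulrA ler_pdivrMr // mulrAC ler_pdivlMr //.
have : 1 <= z ^+ 2 / r ^+ 2 by rewrite ler_pdivlMr // mul1r.
have r2i : 0 <= (r ^+ 2)^-1 by rewrite invr_ge0 ltW.
move=> h; have h2 : 0 <= e ^+ 2 / r ^+ 2 by rewrite mulr_ge0 // ltW.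
have -> : e * (1 + r ^- 2) * 2 * (e ^+ 2 + z ^+ 2) =
  2 * e * (e ^+ 2 + z ^+ 2 + e ^+ 2 / r ^+ 2 + z ^+ 2 / r ^+ 2) by ring.
by rewrite ler_wpM2l ?mulr_ge0 ?ltW //; lra.
Qed.

Lemma Rintegral_poisson_ker2 (R : realType) (e1 e2 : R) (y : R * R) :
  0 < e1 -> 0 < e2 ->
  Rintegral (leb2 R) setT
    (fun x => poisson_ker e1 (x.1 - y.1) * poisson_ker e2 (x.2 - y.2)) = 4 * pi ^+ 2.
Proof.
move=> e10 e20.
rewrite (Rintegral_tensor (integrable_poisson_ker y.1 e10) (integrable_poisson_ker y.2 e20)).
by rewrite !Rintegral_poisson_ker //; ring.
Qed.

Lemma integrable_poisson_ker2 (R : realType) (e1 e2 : R) (y : R * R) :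
  0 < e1 -> 0 < e2 ->
  (leb2 R).-integrable setT (EFin \o
    (fun x => poisson_ker e1 (x.1 - y.1) * poisson_ker e2 (x.2 - y.2))).
Proof.
move=> e10 e20.
exact: (integrable_tensor (integrable_poisson_ker y.1 e10) (integrable_poisson_ker y.2 e20)).
Qed.

(** In the square of half-side [r] around [y] the oscillation of [phi] is at most [h]. Outside it
    one of the two coordinates is in the tail, and each of these two cases costs [2 * M] times the
    tail factor; all the products of kernels have mass [4 * pi ^+ 2]. *)
Lemma poisson_approx_bound (R : realType) (phi : R * R -> R) (y : R * R)
    (M h r e : R) :
  measurable_fun setT phi -> (forall x, `|phi x| <= M) ->
  0 < r -> 0 < e -> 0 <= h ->
  (forall x, `|x.1 - y.1| < r -> `|x.2 - y.2| < r -> `|phi x - phi y| <= h) ->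
  `|Rintegral (leb2 R) setT (fun x =>
      poisson_ker e (x.1 - y.1) * poisson_ker e (x.2 - y.2) * phi x)
    - 4 * pi ^+ 2 * phi y|
  <= 4 * pi ^+ 2 * (h + 4 * M * (1 + r ^- 2) * e).
Proof.
move=> mphi phiM r0 e0 h0 phih.
pose P a b (x : R * R) := poisson_ker a (x.1 - y.1) * poisson_ker b (x.2 - y.2).
have Pi a b : 0 < a -> 0 < b -> (leb2 R).-integrable setT (EFin \o P a b).
  exact: integrable_poisson_ker2.
have PI a b : 0 < a -> 0 < b -> Rintegral (leb2 R) setT (P a b) = 4 * pi ^+ 2.
  exact: Rintegral_poisson_ker2.
have P0 a b x : 0 < a -> 0 < b -> 0 <= P a b x.
  by move=> a0 b0; rewrite mulr_ge0 // poisson_ker_ge0.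
have M0 : 0 <= M by apply: le_trans (phiM y).
rewrite -(PI e e e0 e0) -RintegralZr //; last exact: Pi.
have mP a b : 0 < a -> 0 < b -> measurable_fun setT (P a b).
  by move=> a0 b0; apply/measurable_EFinP; exact: measurable_int (Pi a b a0 b0).
rewrite -RintegralB //; last 2 first.
- by apply: (@integrableMr_bounded _ _ _ _ _ _ _ M) => //; exact: Pi.
- by apply: (@integrableMr_bounded _ _ _ _ _ _ _ M) => //; exact: Pi.
pose C := 2 * M * (e * (1 + r ^- 2)).
have rr : 0 <= r ^- 2 by rewrite invr_ge0 exprn_ge0 // ltW.
have C0 : 0 <= C by rewrite /C !mulr_ge0 ?addr_ge0 // ltW.
pose G x := h * P e e x + (C * P 1 e x + C * P e 1 x).
have iZ k a b : 0 < a -> 0 < b ->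
    (leb2 R).-integrable setT (EFin \o (fun x => k * P a b x)).
  move=> a0 b0; rewrite (_ : _ \o _ = (fun x => k%:E * (P a b x)%:E)%E) //.
  by apply: integrableZl => //; exact: Pi.
have iG : (leb2 R).-integrable setT (EFin \o (fun x => C * P 1 e x + C * P e 1 x)).
  rewrite (_ : _ \o _ = (EFin \o (fun x => C * P 1 e x)%R)
    \+ (EFin \o (fun x => C * P e 1 x)%R))%E //.
  by apply: integrableD => //; exact: iZ.
apply: (@le_trans _ _ (Rintegral (leb2 R) setT G)).
- apply: le_normr_Rintegral_dom => //.
  + by apply: measurable_funB; apply: measurable_funM => //; exact: mP.
  + rewrite (_ : _ \o _ = (EFin \o (fun x => h * P e e x)%R)
      \+ (EFin \o (fun x => C * P 1 e x + C * P e 1 x)%R))%E //.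
    by apply: integrableD => //; exact: iZ.
  + move=> x _; rewrite -mulrBr normrM (ger0_norm (P0 _ _ _ _ _)) // /G.
    have p1 : 0 <= C * P 1 e x by rewrite mulr_ge0 // P0.
    have p2 : 0 <= C * P e 1 x by rewrite mulr_ge0 // P0.
    have p3 : 0 <= h * P e e x by rewrite mulr_ge0 // P0.
    have d2M : `|phi x - phi y| <= 2 * M.
      by rewrite (le_trans (ler_normB _ _)) // mulr2n mulrDl !mul1r lerD.
    have [x1|x1] := ltP `|x.1 - y.1| r; last first.
      apply: (@le_trans _ _ (C * P 1 e x)); last by lra.
      have -> : C * P 1 e x = e * (1 + r ^- 2) * poisson_ker 1 (x.1 - y.1)
        * poisson_ker e (x.2 - y.2) * (2 * M) by rewrite /C /P; ring.
      apply: ler_pM => //; first exact: P0.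
      by rewrite ler_wpM2r ?poisson_ker_ge0 //; exact: poisson_ker_tail.
    have [x2|x2] := ltP `|x.2 - y.2| r; last first.
      apply: (@le_trans _ _ (C * P e 1 x)); last by lra.
      have -> : C * P e 1 x = poisson_ker e (x.1 - y.1) *
        (e * (1 + r ^- 2) * poisson_ker 1 (x.2 - y.2)) * (2 * M).
        by rewrite /C /P; ring.
      apply: ler_pM => //; first exact: P0.
      by rewrite ler_wpM2l ?poisson_ker_ge0 //; exact: poisson_ker_tail.
    rewrite mulrC; apply: (@le_trans _ _ (h * P e e x)); last by lra.
    by rewrite ler_wpM2r ?P0 // phih.
- rewrite RintegralD //; last exact: iZ.
  rewrite RintegralD //; [|exact: iZ|exact: iZ].
  rewrite !RintegralZl //; [|exact: Pi|exact: Pi|exact: Pi].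
  rewrite !PI // /C; lra.
Qed.

(** * Fourier inversion *)

(** Fubini on the product of two planes, where [x] and [xi] live, needs [leb2] as a sigma-finite
    factor. *)
Lemma leb2_sigma_finite (R : realType) : sigma_finite setT (leb2 R).
Proof.
pose F n : set R := `[- n.+1%:R, n.+1%:R]%classic.
exists (fun n => F n `*` F n).
  apply/seteqP; split => // -[x y] _.
  exists (maxn (Num.truncn `|x|) (Num.truncn `|y|)) => //.
  split; rewrite /F /= in_itv /= -ler_norml (le_trans (ltW (truncnS_gt _))) //;
    by rewrite ler_nat ltnS leq_max leqnn ?orbT.
move=> n; split; first by apply: measurableX; exact: measurable_itv.
rewrite /leb2 product_measure1E; [|exact: measurable_itv|exact: measurable_itv].
have muF : (lebesgue_measure (F n) < +oo)%E.
  by rewrite /F lebesgue_measure_itv /=; case: ifP => _; rewrite ?ltry.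
by rewrite lte_mul_pinfty // ge0_fin_numE.
Qed.

HB.instance Definition _ (R : realType) := Measure.on (leb2 R).

HB.instance Definition _ (R : realType) :=
  Measure_isSigmaFinite.Build _ _ _ (leb2 R) (@leb2_sigma_finite R).

Lemma leb2_kernel_swap (R : realType) (f g : R * R -> R)
    (K : (R * R) * (R * R) -> R) :
  (leb2 R).-integrable setT (EFin \o f) -> (leb2 R).-integrable setT (EFin \o g) ->
  measurable_fun setT K -> (forall z, `|K z| <= 1) ->
  Rintegral (leb2 R) setT (fun y => g y * Rintegral (leb2 R) setT (fun x => f x * K (x, y))) =
  Rintegral (leb2 R) setT (fun x => f x * Rintegral (leb2 R) setT (fun y => g y * K (x, y))).
Proof.
exact: (@Rintegral_kernel_swap _ _ _ _ R (leb2 R) (leb2 R) f g K).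
Qed.

Lemma leb2_measurable_kernel (R : realType) (g : R * R -> R)
    (K : (R * R) * (R * R) -> R) :
  (leb2 R).-integrable setT (EFin \o g) ->
  measurable_fun setT K -> (forall z, `|K z| <= 1) ->
  measurable_fun setT (fun x => Rintegral (leb2 R) setT (fun y => g y * K (x, y))).
Proof.
exact: (@measurable_Rintegral_kernel _ _ _ _ R (leb2 R) g K).
Qed.

Lemma cvg_poisson_approx (R : realType) (phi : R * R -> R) (y : R * R) (M : R) :
  continuous phi -> (forall x, `|phi x| <= M) ->
  Rintegral (leb2 R) setT (fun x =>
      poisson_ker n.+1%:R^-1 (x.1 - y.1) * poisson_ker n.+1%:R^-1 (x.2 - y.2) * phi x)
    @[n --> \oo] --> 4 * pi ^+ 2 * phi y.
Proof.
move=> cphi phiM; have mphi := continuous_measurable_fun2 cphi.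
apply/cvgrPdist_le => eps eps0.
have M0 : 0 <= M by apply: le_trans (phiM y).
have pi20 : 0 < 4 * pi ^+ 2 :> R by rewrite mulr_gt0 // exprn_gt0 // pi_gt0.
(* Half of [eps] goes to the oscillation near [y], half to the tails, after division by the mass
   [4 * pi ^+ 2]. *)
pose h := eps / (2 * (4 * pi ^+ 2)).
have h0 : 0 < h by rewrite divr_gt0 // mulr_gt0.
have /nbhs_ballP[r /= r0 hr] := cphi y (ball (phi y) h) (nbhsx_ballx _ _ h0).
pose K := 4 * M * (1 + r ^- 2).
have rr : 0 <= r ^- 2 by rewrite invr_ge0 exprn_ge0 // ltW.
have K0 : 0 <= K by rewrite /K !mulr_ge0 // addr_ge0.
have hK0 : 0 < h / (K + 1) by rewrite divr_gt0 // ltr_wpDl.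
have [N _ hN] := near_infty_natSinv_lt (PosNum hK0).
exists N => // n /= Nn; have := hN n Nn; rewrite /= => nh.
have n0 : 0 < n.+1%:R^-1 :> R by rewrite invr_gt0 ltr0n.
rewrite distrC; apply: le_trans (@poisson_approx_bound R phi y M h r _ mphi phiM r0 n0 (ltW h0) _) _.
  move=> x x1 x2; have : ball y r x by split; rewrite -ball_normE /= distrC.
  by move/hr; rewrite -ball_normE /= distrC => /ltW.
rewrite -/K; have Kn : K * n.+1%:R^-1 <= h.
  apply: (@le_trans _ _ ((K + 1) * n.+1%:R^-1)).
    by rewrite ler_wpM2r ?ltW // ltrDl.
  by rewrite mulrC -ler_pdivlMr ?ltW // ltr_wpDl.
apply: (@le_trans _ _ (4 * pi ^+ 2 * (h + h))); first by rewrite ler_wpM2l ?lerD2l // ltW.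
have hp (p q : R) : p != 0 -> p * (q / (2 * p) + q / (2 * p)) = q.
  by move=> p0; field.
by rewrite /h hp // gt_eqF.
Qed.

(** Equals [int phi x * cos ((x - y).xi - c) dx] by [ft_cos_phase]. *)
Definition dual_wave (R : realType) (phi : R * R -> R) (c : R) (y xi : R * R) : R :=
  ft_cos phi xi * cos (dotp y xi + c) + ft_sin phi xi * sin (dotp y xi + c).

Lemma integrable_cos (R : realType) (f : R * R -> R) (c : R) (xi : R * R) :
  (leb2 R).-integrable setT (EFin \o f) ->
  (leb2 R).-integrable setT (EFin \o (fun x => f x * cos (dotp x xi + c))).
Proof.
move=> fi; apply: (@integrableMr_bounded _ _ _ _ _ _ _ 1) => //.
- exact: measurable_cos_dotpl.
- by move=> x _; exact: cos_max.
Qed.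

Lemma integrable_cosr (R : realType) (f : R * R -> R) (c : R) (x : R * R) :
  (leb2 R).-integrable setT (EFin \o f) ->
  (leb2 R).-integrable setT (EFin \o (fun xi => f xi * cos (dotp x xi + c))).
Proof.
move=> fi; apply: (@integrableMr_bounded _ _ _ _ _ _ _ 1) => //.
- exact: measurable_cos_dotpr.
- by move=> xi _; exact: cos_max.
Qed.

Lemma integrable_sinl (R : realType) (f : R * R -> R) (xi : R * R) :
  (leb2 R).-integrable setT (EFin \o f) ->
  (leb2 R).-integrable setT (EFin \o (fun x => f x * sin (dotp x xi))).
Proof.
move=> fi; rewrite (_ : (fun x => _) = fun x => f x * cos (dotp x xi - pi / 2)).
  exact: integrable_cos.
by apply/funext => x; rewrite sin_cosBpihalf.
Qed.

Lemma integrable_sinr (R : realType) (f : R * R -> R) (c : R) (x : R * R) :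
  (leb2 R).-integrable setT (EFin \o f) ->
  (leb2 R).-integrable setT (EFin \o (fun xi => f xi * sin (dotp x xi + c))).
Proof.
move=> fi; rewrite (_ : (fun xi => _) = fun xi => f xi * cos (dotp x xi + (c - pi / 2))).
  exact: integrable_cosr.
by apply/funext => xi; rewrite sin_cosBpihalf addrA.
Qed.

Lemma ft_cos_phase (R : realType) (f : R * R -> R) (xi : R * R) (t : R) :
  (leb2 R).-integrable setT (EFin \o f) ->
  ft_cos f xi * cos t + ft_sin f xi * sin t =
  Rintegral (leb2 R) setT (fun x => f x * cos (dotp x xi - t)).
Proof.
move=> fi.
have fc : (leb2 R).-integrable setT (EFin \o (fun x => f x * cos (dotp x xi))).
  by have := integrable_cos 0 xi fi; under eq_fun do rewrite addr0.
have fs := integrable_sinl xi fi.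
rewrite /ft_cos /ft_sin -!RintegralZr // -RintegralD //; last 2 first.
- by apply: (@integrableMr_bounded _ _ _ _ _ _ _ 1) => // x _; exact: cos_max.
- by apply: (@integrableMr_bounded _ _ _ _ _ _ _ 1) => // x _; exact: sin_max.
by apply: eq_Rintegral => x _; rewrite cosB mulrDr !mulrA.
Qed.

Lemma measurable_cos_dotpB (R : realType) (c : R) (y : R * R) :
  measurable_fun setT (fun z : (R * R) * (R * R) =>
    cos (dotp (z.1.1 - y.1, z.1.2 - y.2) z.2 + c)).
Proof.
apply: (@measurableT_comp _ _ _ _ _ _ (@cos R)).
  by apply: continuous_measurable_fun; exact: continuous_cos.
apply: measurable_funD => //; apply: measurable_funD; apply: measurable_funM.
- apply: measurable_funB => //; exact: measurableT_comp measurable_fst measurable_fst.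
- exact: measurableT_comp measurable_fst measurable_snd.
- apply: measurable_funB => //; exact: measurableT_comp measurable_snd measurable_fst.
- exact: measurableT_comp measurable_snd measurable_snd.
Qed.

(** Fubini brings the Abel factor onto the wave [cos ((x - y).xi - c)]. As that factor is even, the
    sine part of the wave integrates to 0 and the phase comes out as [cos c]. *)
Lemma Rintegral_abel_dual_wave (R : realType) (phi : R * R -> R) (c e : R) (y : R * R) :
  (leb2 R).-integrable setT (EFin \o phi) -> 0 < e ->
  Rintegral (leb2 R) setT (fun xi =>
    abel_ker e xi.1 * abel_ker e xi.2 * dual_wave phi c y xi) =
  cos c * Rintegral (leb2 R) setT (fun x =>
      poisson_ker e (x.1 - y.1) * poisson_ker e (x.2 - y.2) * phi x).
Proof.
move=> phii e0.
pose K (z : (R * R) * (R * R)) := cos (dotp (z.1.1 - y.1, z.1.2 - y.2) z.2 - c).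
transitivity (Rintegral (leb2 R) setT (fun xi =>
    abel_ker e xi.1 * abel_ker e xi.2 *
    Rintegral (leb2 R) setT (fun x => phi x * K (x, xi)))).
  apply: eq_Rintegral => xi _; congr (_ * _); rewrite /dual_wave ft_cos_phase //.
  apply: eq_Rintegral => x _; congr (_ * cos _); rewrite /dotp /=; ring.
rewrite (leb2_kernel_swap phii (integrable_abel_ker2 e0)); last 2 first.
- exact: measurable_cos_dotpB.
- by move=> z; exact: cos_max.
rewrite -RintegralZl //; last first.
  rewrite (_ : (fun x => _) = fun x => phi x *
    (poisson_ker e (x.1 - y.1) * poisson_ker e (x.2 - y.2))); last first.
    by apply/funext => x; rewrite mulrC.
  apply: (@integrableMr_bounded _ _ _ _ _ _ _ ((2 / e) * (2 / e))) => //.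
    by apply/measurable_EFinP; apply: measurable_int (integrable_poisson_ker2 y e0 e0).
  have pb z : `|poisson_ker e z| <= 2 / e.
    rewrite ger0_norm ?poisson_ker_ge0 // /poisson_ker ler_pdivrMr; last first.
      by rewrite ltr_pwDl ?exprn_gt0 ?sqr_ge0.
    rewrite mulrDr; have -> : 2 / e * e ^+ 2 = 2 * e by field; rewrite gt_eqF.
    by rewrite lerDl mulr_ge0 ?sqr_ge0 // divr_ge0 // ltW.
  by move=> x _; rewrite normrM ler_pM.
apply: eq_Rintegral => x _.
have -> := Rintegral_abel_cos2 (- c) (x.1 - y.1, x.2 - y.2) e0.
by rewrite cosN /=; ring.
Qed.

Lemma integrable_dual_wave (R : realType) (phi : R * R -> R) (c : R) (y : R * R) :
  L1 (ft_cos phi) -> L1 (ft_sin phi) ->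
  (leb2 R).-integrable setT (EFin \o (dual_wave phi c y)).
Proof.
move=> [_ Ci] [_ Si]; rewrite (_ : _ \o _ =
  (EFin \o (fun xi => ft_cos phi xi * cos (dotp y xi + c))%R)
  \+ (EFin \o (fun xi => ft_sin phi xi * sin (dotp y xi + c))%R))%E //.
by apply: integrableD => //; [exact: integrable_cosr|exact: integrable_sinr].
Qed.

(** The regularised integrals have two limits: the right-hand side because the Poisson kernels
    concentrate at [y], and the left-hand side by dominated convergence, the transforms of [phi]
    being integrable. For [c = pi / 2] the result is 0, the vanishing of the imaginary part. *)
Lemma fourier_inversion (R : realType) (phi : R * R -> R) (c M : R) (y : R * R) :
  continuous phi -> (forall x, `|phi x| <= M) ->
  (leb2 R).-integrable setT (EFin \o phi) ->
  L1 (ft_cos phi) -> L1 (ft_sin phi) ->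
  Rintegral (leb2 R) setT (dual_wave phi c y) = cos c * (4 * pi ^+ 2 * phi y).
Proof.
move=> cphi phiM phii LC LS.
have di := integrable_dual_wave c y LC LS.
have md : measurable_fun setT (dual_wave phi c y).
  by apply/measurable_EFinP; exact: measurable_int di.
have e0 n : 0 < n.+1%:R^-1 :> R by rewrite invr_gt0 ltr0n.
have lim1 : Rintegral (leb2 R) setT (fun xi => abel_ker n.+1%:R^-1 xi.1 *
      abel_ker n.+1%:R^-1 xi.2 * dual_wave phi c y xi) @[n --> \oo]
    --> cos c * (4 * pi ^+ 2 * phi y).
  under eq_fun do rewrite Rintegral_abel_dual_wave //.
  by apply: cvgMr; exact: cvg_poisson_approx phiM.
apply: (cvg_unique (@Rhausdorff R) _ lim1).
apply: (@dominated_Rintegral _ _ R (leb2 R) setT (fun n xi => abel_ker n.+1%:R^-1 xi.1 *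
  abel_ker n.+1%:R^-1 xi.2 * dual_wave phi c y xi) _ (fun xi => `|dual_wave phi c y xi|)) => //.
- move=> n; apply: measurable_funM => //; apply/measurable_EFinP.
  exact: measurable_int (integrable_abel_ker2 (e0 n)).
- exact: integrable_norm.
- have a1 n (t : R) : 0 <= abel_ker n.+1%:R^-1 t <= 1.
    by rewrite expR_ge0 /= -[leRHS]expR0 ler_expR oppr_le0 mulr_ge0 // ltW.
  move=> n x _; rewrite normrM ler_piMl // normrM.
  by rewrite mulr_ile1 // ger0_norm; case/andP: (a1 n x.1); case/andP: (a1 n x.2).
- apply: aeW => xi _.
  have a1 t : abel_ker n.+1%:R^-1 t @[n --> \oo] --> (1 : R).
    rewrite -[X in _ --> X]expR0; apply: continuous_cvg; first exact: continuous_expR.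
    rewrite -[X in _ --> X]oppr0 -(mul0r `|t|); apply: cvgN; apply: cvgMl; exact: cvg_harmonic.
  rewrite -[X in _ --> X]mul1r; apply: cvgM; last exact: cvg_cst.
  by rewrite -[X in _ --> X]mul1r; apply: cvgM; exact: a1.
Qed.

(** * Integration by parts *)

Definition cbox (R : realType) (a : R * R) (r : R) : set (R * R) :=
  [set x | `|x.1 - a.1| <= r /\ `|x.2 - a.2| <= r].

Lemma cboxE (R : realType) (a : R * R) (r : R) :
  cbox a r = (`[a.1 - r, a.1 + r]%classic : set R) `*` (`[a.2 - r, a.2 + r]%classic : set R).
Proof.
apply/seteqP; split => -[x y] /=; rewrite /cbox /= !in_itv /= !ler_distl //.
Qed.

Lemma measurable_cbox (R : realType) (a : R * R) (r : R) : measurable (cbox a r).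
Proof. by rewrite cboxE; apply: measurableX; exact: measurable_itv. Qed.

Lemma leb2_cbox (R : realType) (a : R * R) (r : R) : 0 <= r ->
  leb2 R (cbox a r) = (4 * r ^+ 2)%:E.
Proof.
move=> r0; rewrite cboxE /leb2 product_measure1E; [|exact: measurable_itv|exact: measurable_itv].
have E (t : R) : lebesgue_measure (`[t - r, t + r]%classic : set R) = (2 * r)%:E.
  rewrite lebesgue_measure_itv /= lte_fin.
  case: ltP => h; last first.
    by have -> : r = 0; [lra|rewrite mulr0].
  by rewrite -EFinB; congr EFin; lra.
transitivity ((2 * r)%:E * (2 * r)%:E)%E; first by congr (_ * _)%E; exact: E.
by rewrite -EFinM; congr EFin; ring.
Qed.

Lemma integrable_bounded_cbox (R : realType) (h : R * R -> R) (a : R * R) (r C : R) :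
  0 <= r -> measurable_fun setT h -> (forall x, `|h x| <= C) ->
  (forall x, ~ cbox a r x -> h x = 0) ->
  (leb2 R).-integrable setT (EFin \o h) /\
  Rintegral (leb2 R) setT (fun x => `|h x|) <= C * (4 * r ^+ 2).
Proof.
move=> r0 mh hC h0.
have iC : (leb2 R).-integrable (cbox a r) (EFin \o cst C).
  apply: measurable_bounded_integrable => //.
  - exact: measurable_cbox.
  - rewrite [X in (X < _)%E](_ : _ = (4 * r ^+ 2)%:E) ?ltry //; exact: leb2_cbox.
  - by exists `|C|; split => // M /ltW CM x _; exact: CM.
have ih : (leb2 R).-integrable setT (EFin \o h).
  have -> : h = h \_ (cbox a r).
    apply/funext => x; rewrite patchE; case: ifPn => // /negP hx.
    by apply: h0 => /mem_set.
  rewrite -restrict_EFin; apply/integrable_restrict; rewrite ?setTI //.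
    exact: measurable_cbox.
  apply: integrable_dom iC => //; first exact: measurable_cbox.
  exact: measurable_funS mh.
split => //.
have -> : (fun x => `|h x|) = (fun x => `|h x|) \_ (cbox a r).
  apply/funext => x; rewrite patchE; case: ifPn => // /negP hx.
  by rewrite h0 ?normr0 // => /mem_set.
rewrite -Rintegral_mkcond.
have mb := @measurable_cbox R a r.
apply: (@le_trans _ _ (Rintegral (leb2 R) (cbox a r) (cst C))).
  apply: le_Rintegral => //.
  apply: integrable_dom iC => // [|x _]; last by rewrite normr_id.
  by apply: measurableT_comp => //; exact: measurable_funS mh.
rewrite Rintegral_cst //.
by rewrite [X in fine X](_ : _ = (4 * r ^+ 2)%:E) //; exact: leb2_cbox.
Qed.

Lemma continuous_cbox_bounded (R : realType) (h : R * R -> R) (a : R * R) (r : R) :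
  continuous h -> (forall x, ~ cbox a r x -> h x = 0) ->
  exists M, forall x, `|h x| <= M.
Proof.
move=> ch h0.
have cpt : compact (cbox a r).
  by rewrite cboxE; apply: compact_setX; exact: segment_compact.
have : compact (h @` cbox a r).
  by apply: continuous_compact => //; exact: continuous_subspaceT.
move=> /compact_bounded[M [_ hM]].
exists (`|M| + 1) => x; have [xb|xb] := pselect (cbox a r x); last first.
  by rewrite h0 // normr0 addr_ge0.
by apply: (hM (`|M| + 1)); [rewrite ltr_pwDr // ler_norm|exists x].
Qed.

Lemma continuous_cbox_integrable (R : realType) (h : R * R -> R) (a : R * R) (r : R) :
  continuous h -> (forall x, ~ cbox a r x -> h x = 0) ->
  (leb2 R).-integrable setT (EFin \o h).
Proof.
move=> ch h0; have [M hM] := continuous_cbox_bounded ch h0.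
have mh := continuous_measurable_fun2 ch.
apply: (proj1 (@integrable_bounded_cbox R h a `|r| M _ mh hM _)) => //.
move=> x xb; apply: h0 => -[x1 x2]; apply: xb.
by split; apply: le_trans (ler_norm r).
Qed.

Lemma continuous_support_integrable1 (R : realType) (f : R -> R) (M : R) :
  continuous f -> (forall x, M < `|x| -> f x = 0) ->
  (@lebesgue_measure R).-integrable setT (EFin \o f).
Proof.
move=> cf f0; have -> : f = f \_ `[- `|M|, `|M|].
  apply/funext => x; rewrite patchE; case: ifPn => // /negP hx; apply: f0.
  rewrite ltNge; apply/negP => h; apply: hx; apply/mem_set => /=.
  by rewrite in_itv /= -ler_norml (le_trans h) // ler_norm.
rewrite -restrict_EFin; apply/integrable_restrict; rewrite ?setTI //.
apply: continuous_compact_integrable; first exact: segment_compact.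
exact: continuous_subspaceT.
Qed.

(** The difference of the two integrands is the derivative of [f x * cos (z * x + c)], which
    vanishes far out on both sides. A derivative thus costs a factor [z] and a quarter turn of the
    phase. *)
Lemma Rintegral_by_parts_cos (R : realType) (f f1 : R -> R) (M z c : R) :
  continuous f1 -> (forall x : R, is_derive x (1 : R) f (f1 x)) ->
  (forall x, M < `|x| -> f x = 0) -> (forall x, M < `|x| -> f1 x = 0) ->
  Rintegral (@lebesgue_measure R) setT (fun x => f1 x * cos (z * x + c)) =
  z * Rintegral (@lebesgue_measure R) setT (fun x => f x * cos (z * x + (c - pi / 2))).
Proof.
move=> cf1 df f0 f10.
have cf : continuous f.
  move=> x; apply: differentiable_continuous; apply/derivable1_diffP.
  by have [] := df x.
have ccos k : continuous (fun x : R => cos (z * x + k)) by exact: continuous_cos_affine.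
have i1 : (@lebesgue_measure R).-integrable setT (EFin \o (fun x => f1 x * cos (z * x + c))).
  apply: (@continuous_support_integrable1 R _ M); last by move=> x /f10 ->; rewrite mul0r.
  by move=> x; apply: continuousM; [exact: cf1|exact: ccos].
have i2 : (@lebesgue_measure R).-integrable setT
    (EFin \o (fun x => f x * cos (z * x + (c - pi / 2)))).
  apply: (@continuous_support_integrable1 R _ M); last by move=> x /f0 ->; rewrite mul0r.
  by move=> x; apply: continuousM; [exact: cf|exact: ccos].
rewrite -RintegralZl //; apply/eqP; rewrite -subr_eq0; apply/eqP.
have i3 : (@lebesgue_measure R).-integrable setT
    (EFin \o (fun x => z * (f x * cos (z * x + (c - pi / 2))))).
  rewrite (_ : _ \o _ = (fun x => z%:E * (f x * cos (z * x + (c - pi / 2)))%R%:E)%E) //.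
  exact: integrableZl.
rewrite -RintegralB //.
apply: (@improper_FTC R _ (fun x => f x * cos (z * x + c))).
- rewrite (_ : _ \o _ = (EFin \o (fun x => f1 x * cos (z * x + c))%R)
    \- (EFin \o (fun x => z * (f x * cos (z * x + (c - pi / 2))))%R))%E //.
  exact: integrableB.
- move=> x; apply: cvgB; first by apply: cvgM; [exact: cf1|exact: ccos].
  by apply: cvgMr; apply: cvgM; [exact: cf|exact: ccos].
- move=> x; have dfx := df x; apply: is_derive_eq.
  rewrite /GRing.scale /= addrA -sin_cosBpihalf; ring.
- apply: cvg_near_cst; exists (Num.truncn `|M|) => // n /= hn.
  have Mn : M < n.+1%:R.
    rewrite (le_lt_trans (ler_norm M)) // (lt_le_trans (truncnS_gt _)) //.
    by rewrite ler_nat ltnS.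
  by rewrite !f0 ?normrN ?ger0_norm // !mul0r subrr.
Qed.

(** The phase [0] gives [ft_cos], and [- pi / 2] gives [ft_sin]. *)
Definition ft_phase (R : realType) (c : R) (f : R * R -> R) (xi : R * R) : R :=
  Rintegral (leb2 R) setT (fun x => f x * cos (dotp x xi + c)).

Lemma continuous_slice1 (R : realType) (h : R * R -> R) (y : R) :
  continuous h -> continuous (fun x => h (x, y)).
Proof.
move=> ch x; apply: (@cvg_comp _ _ _ (fun x => (x, y)) h); last exact: ch.
move=> P /nbhs_ballP[e e0 h1]; apply/nbhs_ballP; exists e => // t bt.
by apply: h1; split => //; exact: ballxx.
Qed.

Lemma continuous_slice2 (R : realType) (h : R * R -> R) (x : R) :
  continuous h -> continuous (fun y => h (x, y)).
Proof.
move=> ch y; apply: (@cvg_comp _ _ _ (fun y => (x, y)) h); last exact: ch.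
move=> P /nbhs_ballP[e e0 h1]; apply/nbhs_ballP; exists e => // t bt.
by apply: h1; split => //; exact: ballxx.
Qed.

Lemma leb2_fubini12 (R : realType) (h : R * R -> R) :
  (leb2 R).-integrable setT (EFin \o h) ->
  Rintegral (leb2 R) setT h = Rintegral (@lebesgue_measure R) setT
    (fun x => Rintegral (@lebesgue_measure R) setT (fun y => h (x, y))).
Proof. exact: Rintegral_prod12. Qed.

Lemma leb2_fubini21 (R : realType) (h : R * R -> R) :
  (leb2 R).-integrable setT (EFin \o h) ->
  Rintegral (leb2 R) setT h = Rintegral (@lebesgue_measure R) setT
    (fun y => Rintegral (@lebesgue_measure R) setT (fun x => h (x, y))).
Proof. exact: Rintegral_prod21. Qed.

Lemma integrable_scale (R : realType) (k : R) (h : R * R -> R) :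
  (leb2 R).-integrable setT (EFin \o h) ->
  (leb2 R).-integrable setT (EFin \o (fun x => k * h x)).
Proof. by move=> hi; exact: (integrableZl measurableT k hi). Qed.

Lemma ft_phase_derive1 (R : realType) (h h1 : R * R -> R) (r c : R) (xi : R * R) :
  continuous h -> continuous h1 ->
  (forall x y : R, is_derive x (1 : R) (fun t => h (t, y)) (h1 (x, y))) ->
  (forall x, ~ cbox (0, 0) r x -> h x = 0) ->
  (forall x, ~ cbox (0, 0) r x -> h1 x = 0) ->
  ft_phase c h1 xi = xi.1 * ft_phase (c - pi / 2) h xi.
Proof.
move=> ch ch1 dh h0 h10.
have i0 := continuous_cbox_integrable ch h0.
have i1 := continuous_cbox_integrable ch1 h10.
rewrite /ft_phase -RintegralZl //; last exact: integrable_cos.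
rewrite (leb2_fubini21 (integrable_cos c xi i1)).
rewrite (leb2_fubini21 (integrable_scale xi.1 (integrable_cos (c - pi / 2) xi i0))).
apply: eq_Rintegral => y _.
have S (k : R * R -> R) : (forall x, ~ cbox (0, 0) r x -> k x = 0) ->
  forall x, r < `|x| -> k (x, y) = 0.
  by move=> k0 x rx; apply: k0 => -[/=]; rewrite subr0 leNgt rx.
rewrite (_ : (fun x => _) = fun x => h1 (x, y) * cos (xi.1 * x + (y * xi.2 + c))); last first.
  by apply/funext => x; rewrite /dotp /= addrA (mulrC x).
rewrite (@Rintegral_by_parts_cos R (fun x => h (x, y)) _ r) //.
- rewrite -RintegralZl //.
    by apply: eq_Rintegral => x _; rewrite /dotp /= !addrA (mulrC x).
  apply: (@integrableMr_bounded _ (measurableTypeR R) _ _ _ _ _ 1) => //.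
  + by apply: continuous_measurable_fun; exact: continuous_cos_affine.
  + by move=> x _; exact: cos_max.
  + apply: (@continuous_support_integrable1 R _ r); last exact: S.
    exact: continuous_slice1.
- exact: continuous_slice1.
- exact: (S h).
- exact: (S h1).
Qed.

Lemma ft_phase_derive2 (R : realType) (h h1 : R * R -> R) (r c : R) (xi : R * R) :
  continuous h -> continuous h1 ->
  (forall x y : R, is_derive y (1 : R) (fun t => h (x, t)) (h1 (x, y))) ->
  (forall x, ~ cbox (0, 0) r x -> h x = 0) ->
  (forall x, ~ cbox (0, 0) r x -> h1 x = 0) ->
  ft_phase c h1 xi = xi.2 * ft_phase (c - pi / 2) h xi.
Proof.
move=> ch ch1 dh h0 h10.
have i0 := continuous_cbox_integrable ch h0.
have i1 := continuous_cbox_integrable ch1 h10.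
rewrite /ft_phase -RintegralZl //; last exact: integrable_cos.
rewrite (leb2_fubini12 (integrable_cos c xi i1)).
rewrite (leb2_fubini12 (integrable_scale xi.2 (integrable_cos (c - pi / 2) xi i0))).
apply: eq_Rintegral => x _.
have S (k : R * R -> R) : (forall x, ~ cbox (0, 0) r x -> k x = 0) ->
  forall y, r < `|y| -> k (x, y) = 0.
  by move=> k0 y rx; apply: k0 => -[/= _]; rewrite subr0 leNgt rx.
rewrite (_ : (fun y => _) = fun y => h1 (x, y) * cos (xi.2 * y + (x * xi.1 + c))); last first.
  by apply/funext => y; rewrite /dotp /= addrCA addrA (mulrC y).
rewrite (@Rintegral_by_parts_cos R (fun y => h (x, y)) _ r) //.
- rewrite -RintegralZl //.
    by apply: eq_Rintegral => y _; rewrite /dotp /= !addrA (mulrC y) [xi.2 * y + _]addrC.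
  apply: (@integrableMr_bounded _ (measurableTypeR R) _ _ _ _ _ 1) => //.
  + by apply: continuous_measurable_fun; exact: continuous_cos_affine.
  + by move=> y _; exact: cos_max.
  + apply: (@continuous_support_integrable1 R _ r); last exact: S.
    exact: continuous_slice2.
- exact: continuous_slice2.
- exact: (S h).
- exact: (S h1).
Qed.

(** * The multiplier of R_1^2 *)

(** For [m] the symbol of R_1^2, [c = 0] gives the frequency integral of the first equation in
    [is_R1sq], and [c = pi / 2] that of the second. *)
Definition pairing (R : realType) (m phi : R * R -> R) (c : R) (f : R * R -> R) : R :=
  Rintegral (leb2 R) setT (fun xi => m xi *
    (ft_phase c f xi * ft_cos phi xi + ft_phase (c - pi / 2) f xi * ft_sin phi xi)).

(** For [c = 0] this is [4 * pi ^+ 2] times the multiplier [m] applied to the test function, by the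
    inversion formula. *)
Definition dual_pot (R : realType) (m phi : R * R -> R) (c : R) (y : R * R) : R :=
  Rintegral (leb2 R) setT (fun xi => m xi * dual_wave phi c y xi).

Lemma integrable_add2 (R : realType) (h k : R * R -> R) :
  (leb2 R).-integrable setT (EFin \o h) -> (leb2 R).-integrable setT (EFin \o k) ->
  (leb2 R).-integrable setT (EFin \o (fun x => h x + k x)).
Proof. by move=> hi ki; exact: (integrableD measurableT hi ki). Qed.

Lemma integrable_mul_bounded (R : realType) (m h : R * R -> R) (M : R) :
  measurable_fun setT m -> (forall x, `|m x| <= M) ->
  (leb2 R).-integrable setT (EFin \o h) ->
  (leb2 R).-integrable setT (EFin \o (fun x => m x * h x)).
Proof.
move=> mm m1 hi; under eq_fun do rewrite mulrC.
exact: (@integrableMr_bounded _ _ _ _ _ _ _ M).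
Qed.

Lemma measurable_ft_phase (R : realType) (c : R) (f : R * R -> R) :
  (leb2 R).-integrable setT (EFin \o f) -> measurable_fun setT (ft_phase c f).
Proof.
move=> fi; rewrite /ft_phase.
have := @leb2_measurable_kernel R f (fun z => cos (dotp z.1 z.2 + c)) fi.
move=> /(_ (measurable_cos_dotp c) (fun z => cos_max _)).
by congr measurable_fun; apply/funext => xi; apply: eq_Rintegral => x _;
  rewrite /dotp /= [xi.1 * _]mulrC [xi.2 * _]mulrC.
Qed.

Lemma ft_phase_bound (R : realType) (c : R) (f : R * R -> R) (xi : R * R) :
  (leb2 R).-integrable setT (EFin \o f) ->
  `|ft_phase c f xi| <= Rintegral (leb2 R) setT (fun x => `|f x|).
Proof.
move=> fi; apply: le_normr_Rintegral_dom => //.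
- by apply/measurable_EFinP; exact: measurable_int (integrable_cos c xi fi).
- exact: integrable_norm.
- by move=> x _; rewrite normrM ler_piMr // cos_max.
Qed.

Lemma integrable_symbol_dual (R : realType) (m phi : R * R -> R) (c : R) (y : R * R) :
  measurable_fun setT m -> (forall xi, `|m xi| <= 1) ->
  L1 (ft_cos phi) -> L1 (ft_sin phi) ->
  (leb2 R).-integrable setT (EFin \o (fun xi => m xi * dual_wave phi c y xi)).
Proof.
by move=> mm m1 LC LS; apply: integrable_mul_bounded m1 _ => //; exact: integrable_dual_wave.
Qed.

Lemma dual_potE (R : realType) (m phi : R * R -> R) (c : R) (y : R * R) :
  measurable_fun setT m -> (forall xi, `|m xi| <= 1) ->
  L1 (ft_cos phi) -> L1 (ft_sin phi) ->
  dual_pot m phi c y =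
    Rintegral (leb2 R) setT (fun xi => m xi * ft_cos phi xi * cos (dotp y xi + c))
  + Rintegral (leb2 R) setT
      (fun xi => m xi * ft_sin phi xi * cos (dotp y xi + (c - pi / 2))).
Proof.
move=> mm m1 [_ Ci] [_ Si]; rewrite -RintegralD //; last 2 first.
- by apply: integrable_cosr; exact: integrable_mul_bounded m1 _.
- by apply: integrable_cosr; exact: integrable_mul_bounded m1 _.
apply: eq_Rintegral => xi _.
by rewrite /dual_wave addrA -sin_cosBpihalf; ring.
Qed.

Lemma measurable_dual_pot (R : realType) (m phi : R * R -> R) (c : R) :
  measurable_fun setT m -> (forall xi, `|m xi| <= 1) ->
  L1 (ft_cos phi) -> L1 (ft_sin phi) -> measurable_fun setT (dual_pot m phi c).
Proof.
move=> mm m1 LC LS; have [_ Ci] := LC; have [_ Si] := LS.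
have E y := dual_potE c y mm m1 LC LS; rewrite (funext E).
apply: measurable_funD.
- apply: (@leb2_measurable_kernel R _ (fun z => cos (dotp z.1 z.2 + c))).
  + exact: integrable_mul_bounded m1 _.
  + exact: measurable_cos_dotp.
  + by move=> z; exact: cos_max.
- apply: (@leb2_measurable_kernel R _ (fun z => cos (dotp z.1 z.2 + (c - pi / 2)))).
  + exact: integrable_mul_bounded m1 _.
  + exact: measurable_cos_dotp.
  + by move=> z; exact: cos_max.
Qed.

Lemma dual_pot_bounded (R : realType) (m phi : R * R -> R) (c : R) :
  measurable_fun setT m -> (forall xi, `|m xi| <= 1) ->
  L1 (ft_cos phi) -> L1 (ft_sin phi) ->
  exists M, forall y, `|dual_pot m phi c y| <= M.
Proof.
move=> mm m1 LC LS; have [_ Ci] := LC; have [_ Si] := LS.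
exists (Rintegral (leb2 R) setT (fun xi => `|ft_cos phi xi| + `|ft_sin phi xi|)) => y.
rewrite /dual_pot; apply: le_normr_Rintegral_dom => //.
- by apply/measurable_EFinP; exact: measurable_int (integrable_symbol_dual c y mm m1 LC LS).
- by apply: integrable_add2; exact: integrable_norm.
- move=> xi _; apply: (@le_trans _ _ `|dual_wave phi c y xi|).
    by rewrite normrM ler_piMl.
  by rewrite (le_trans (ler_normD _ _)) // !normrM lerD // ler_piMr // ?cos_max ?sin_max.
Qed.

(** Once the multiplier is moved to the test function, the pairing is the integral of [f] against
    one bounded function; linearity and summation of series in [f] then need no Fourier analysis. *)
Lemma pairing_swap (R : realType) (m phi f : R * R -> R) (c : R) :
  measurable_fun setT m -> (forall xi, `|m xi| <= 1) ->
  L1 (ft_cos phi) -> L1 (ft_sin phi) ->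
  (leb2 R).-integrable setT (EFin \o f) ->
  pairing m phi c f = Rintegral (leb2 R) setT (fun y => f y * dual_pot m phi c y).
Proof.
move=> mm m1 LC LS fi; have [_ Ci] := LC; have [_ Si] := LS.
have mCi : (leb2 R).-integrable setT (EFin \o (fun xi => m xi * ft_cos phi xi)).
  exact: integrable_mul_bounded m1 _.
have mSi : (leb2 R).-integrable setT (EFin \o (fun xi => m xi * ft_sin phi xi)).
  exact: integrable_mul_bounded m1 _.
have T k (g : R * R -> R) : (leb2 R).-integrable setT (EFin \o g) ->
    (leb2 R).-integrable setT (EFin \o (fun xi => g xi * ft_phase k f xi)).
  move=> gi; apply: (@integrableMr_bounded _ _ _ _ _ _ _
    (Rintegral (leb2 R) setT (fun x => `|f x|))) => //.
    exact: measurable_ft_phase.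
  by move=> x _; exact: ft_phase_bound.
have S k (g : R * R -> R) : (leb2 R).-integrable setT (EFin \o g) ->
    Rintegral (leb2 R) setT (fun xi => g xi * ft_phase k f xi) =
    Rintegral (leb2 R) setT (fun y => f y *
      Rintegral (leb2 R) setT (fun xi => g xi * cos (dotp y xi + k))).
  move=> gi; apply: (@leb2_kernel_swap R f g (fun z => cos (dotp z.1 z.2 + k))) => //.
    exact: measurable_cos_dotp.
  by move=> z; exact: cos_max.
have U k (g : R * R -> R) : (leb2 R).-integrable setT (EFin \o g) ->
    (leb2 R).-integrable setT (EFin \o (fun y => f y *
      Rintegral (leb2 R) setT (fun xi => g xi * cos (dotp y xi + k)))).
  move=> gi; apply: (@integrableMr_bounded _ _ _ _ _ _ _
    (Rintegral (leb2 R) setT (fun x => `|g x|))) => //.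
    apply: (@leb2_measurable_kernel R _ (fun z => cos (dotp z.1 z.2 + k))) => //.
      exact: measurable_cos_dotp.
    by move=> z; exact: cos_max.
  move=> y _; apply: le_normr_Rintegral_dom => //.
  - by apply/measurable_EFinP; exact: measurable_int (integrable_cosr k y gi).
  - exact: integrable_norm.
  - by move=> x _; rewrite normrM ler_piMr // cos_max.
transitivity (Rintegral (leb2 R) setT (fun xi => m xi * ft_cos phi xi * ft_phase c f xi)
  + Rintegral (leb2 R) setT (fun xi => m xi * ft_sin phi xi * ft_phase (c - pi / 2) f xi)).
  rewrite -RintegralD //; [|exact: T|exact: T].
  by apply: eq_Rintegral => xi _; ring.
rewrite !S // -RintegralD //; [|exact: U|exact: U].
by apply: eq_Rintegral => y _; rewrite dual_potE // mulrDr.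
Qed.

Lemma measurable_R1sq_symbol (R : realType) : measurable_fun setT (@R1sq_symbol R).
Proof.
have m1 : measurable_fun setT (fun xi : R * R => xi.1 ^+ 2).
  exact: (measurable_funX 2 measurable_fst).
have m2 : measurable_fun setT (fun xi : R * R => xi.2 ^+ 2).
  exact: (measurable_funX 2 measurable_snd).
apply: measurable_funM; first exact: measurableT_comp.
(* Inversion is discontinuous at 0, so this point is split off. *)
have mi : measurable_fun setT (@GRing.inv R).
  have -> : [set: R] = [set 0] `|` ~` [set 0] by rewrite setUv.
  have ms : measurable [set (0 : R)] by exact: measurable_set1.
  apply/(measurable_funU _ ms (measurableC ms)); split.
    exact: measurable_fun_set1.
  apply: open_continuous_measurable_fun.
    by apply: closed_openC; exact: closed_eq.
  by move=> x; rewrite inE => /eqP x0; exact: inv_continuous.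
exact: measurableT_comp mi (measurable_funD m1 m2).
Qed.

Lemma R1sq_symbol_le1 (R : realType) (xi : R * R) : `|R1sq_symbol xi| <= 1.
Proof.
have h1 := sqr_ge0 xi.1; have h2 := sqr_ge0 xi.2.
rewrite /R1sq_symbol mulNr normrN ger0_norm; last by rewrite divr_ge0 // addr_ge0.
have [E|E] := eqVneq (xi.1 ^+ 2 + xi.2 ^+ 2) 0; first by rewrite E invr0 mulr0.
rewrite ler_pdivrMr ?mul1r ?lerDl //.
by rewrite lt_neqAle eq_sym E addr_ge0.
Qed.

(** For the multiplier 1, [dual_pot] is the inversion integral and returns [phi]. *)
Lemma parseval (R : realType) (phi h : R * R -> R) (c M : R) :
  continuous phi -> (forall x, `|phi x| <= M) ->
  (leb2 R).-integrable setT (EFin \o phi) ->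
  L1 (ft_cos phi) -> L1 (ft_sin phi) ->
  (leb2 R).-integrable setT (EFin \o h) ->
  pairing (fun=> 1) phi c h =
  cos c * (4 * pi ^+ 2) * Rintegral (leb2 R) setT (fun x => h x * phi x).
Proof.
move=> cphi phiM phii LC LS hi.
rewrite pairing_swap //; last by move=> _; rewrite normr1.
rewrite -RintegralZl //; last first.
  apply: (@integrableMr_bounded _ _ _ _ _ _ _ M) => //.
  exact: continuous_measurable_fun2.
apply: eq_Rintegral => y _; rewrite /dual_pot.
under eq_Rintegral do rewrite mul1r.
by rewrite (fourier_inversion c y cphi phiM phii LC LS); ring.
Qed.

Lemma ft_phaseN (R : realType) (c : R) (f : R * R -> R) (xi : R * R) :
  (leb2 R).-integrable setT (EFin \o f) ->
  ft_phase c (fun x => - f x) xi = - ft_phase c f xi.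
Proof.
move=> fi; rewrite -mulN1r /ft_phase -RintegralZl //; last exact: integrable_cos.
by apply: eq_Rintegral => x _; rewrite mulN1r mulNr.
Qed.

Lemma ft_phaseD (R : realType) (c : R) (f g : R * R -> R) (xi : R * R) :
  (leb2 R).-integrable setT (EFin \o f) -> (leb2 R).-integrable setT (EFin \o g) ->
  ft_phase c (fun x => f x + g x) xi = ft_phase c f xi + ft_phase c g xi.
Proof.
move=> fi gi; rewrite /ft_phase -RintegralD //; [|exact: integrable_cos..].
by apply: eq_Rintegral => x _; rewrite mulrDl.
Qed.

(** On the Fourier side [- Lap v] carries the factor [|xi|^2], which cancels the denominator of the
    symbol and leaves the transform of [v11]; Parseval finishes. Compact support of [v] is what
    allows the integrations by parts. *)
Lemma pairing_laplacian (R : realType) (phi v v1 v11 v2 v22 : R * R -> R) (c M r : R) :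
  continuous phi -> (forall x, `|phi x| <= M) ->
  (leb2 R).-integrable setT (EFin \o phi) ->
  L1 (ft_cos phi) -> L1 (ft_sin phi) ->
  continuous v -> continuous v1 -> continuous v11 -> continuous v2 -> continuous v22 ->
  (forall x y : R, is_derive x (1 : R) (fun t => v (t, y)) (v1 (x, y))) ->
  (forall x y : R, is_derive x (1 : R) (fun t => v1 (t, y)) (v11 (x, y))) ->
  (forall x y : R, is_derive y (1 : R) (fun t => v (x, t)) (v2 (x, y))) ->
  (forall x y : R, is_derive y (1 : R) (fun t => v2 (x, t)) (v22 (x, y))) ->
  (forall x, ~ cbox (0, 0) r x ->
    [/\ v x = 0, v1 x = 0, v11 x = 0, v2 x = 0 & v22 x = 0]) ->
  pairing (@R1sq_symbol R) phi c (fun x => - (v11 x + v22 x)) =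
  cos c * (4 * pi ^+ 2) * Rintegral (leb2 R) setT (fun x => v11 x * phi x).
Proof.
move=> cphi phiM phii LC LS cv cv1 cv11 cv2 cv22 dv dv1 dv2 dv22 sup.
have s0 x : ~ cbox (0, 0) r x -> v x = 0 by move/sup => [].
have s1 x : ~ cbox (0, 0) r x -> v1 x = 0 by move/sup => [].
have s11 x : ~ cbox (0, 0) r x -> v11 x = 0 by move/sup => [].
have s2 x : ~ cbox (0, 0) r x -> v2 x = 0 by move/sup => [].
have s22 x : ~ cbox (0, 0) r x -> v22 x = 0 by move/sup => [].
have i11 := continuous_cbox_integrable cv11 s11.
have i22 := continuous_cbox_integrable cv22 s22.
rewrite -(parseval c cphi phiM phii LC LS i11).
have key k xi : R1sq_symbol xi * ft_phase k (fun x => - (v11 x + v22 x)) xi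
    = ft_phase k v11 xi.
  rewrite ft_phaseN; last exact: integrable_add2.
  rewrite ft_phaseD //.
  rewrite (ft_phase_derive1 k xi cv1 cv11 dv1 s1 s11).
  rewrite (ft_phase_derive2 k xi cv2 cv22 dv22 s2 s22).
  rewrite (ft_phase_derive1 _ xi cv cv1 dv s0 s1).
  rewrite (ft_phase_derive2 _ xi cv cv2 dv2 s0 s2).
  set V := ft_phase _ _ _; rewrite /R1sq_symbol.
  (* At the origin nothing cancels, but both sides vanish since the transform of [v11] has the
     factor [xi.1 ^+ 2]. *)
  have [E|E] := eqVneq (xi.1 ^+ 2 + xi.2 ^+ 2) 0; last by field.
  have /eqP x1 : xi.1 == 0.
    by move/eqP: E; rewrite paddr_eq0 ?sqr_ge0 // sqrf_eq0 => /andP[].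
  by rewrite x1 expr0n oppr0 !mul0r.
apply: eq_Rintegral => xi _; rewrite mul1r mulrDr !mulrA !key //.
Qed.

(** * A radial bump and its potential *)

(** For [s <= 1] this is the third-order Taylor polynomial of [- ln s] at 1, which
    makes the gluing C^2 and [- Lap (prof (|x|^2)) = 12 (1 - |x|^2)^2] inside the
    unit disc. *)
Definition prof (R : realType) (s : R) : R :=
  if s <= 1 then (1 - s) + (1 - s) ^+ 2 / 2 + (1 - s) ^+ 3 / 3 else - ln s.
Definition prof1 (R : realType) (s : R) : R :=
  if s <= 1 then - (s ^+ 2 - 3 * s + 3) else - s^-1.
Definition prof2 (R : realType) (s : R) : R :=
  if s <= 1 then 3 - 2 * s else (s ^+ 2)^-1.
Definition cap (R : realType) (s : R) : R := if s <= 1 then (1 - s) ^+ 2 else 0.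
Definition cap1 (R : realType) (s : R) : R := if s <= 1 then - 2 * (1 - s) else 0.

Lemma is_derive_prof (R : realType) (s : R) : is_derive s (1 : R) (@prof R) (prof1 s).
Proof.
apply: (@is_derive_glue R (fun s : R => (1 - s) + (1 - s) ^+ 2 / 2 + (1 - s) ^+ 3 / 3 : R)
  (fun s : R => - ln s : R)
  (fun s : R => - (s ^+ 2 - 3 * s + 3) : R) (fun s : R => - s^-1 : R) 1) => [x _|x x1||].
- by apply: is_derive_eq; rewrite /GRing.scale /=; field.
- have x0 : 0 < x by apply: lt_le_trans x1.
  have dl := is_derive1_ln x0.
  exact: is_deriveN.
- by rewrite ln1; ring.
- by rewrite invr1; ring.
Qed.

Lemma is_derive_prof1 (R : realType) (s : R) : is_derive s (1 : R) (@prof1 R) (prof2 s).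
Proof.
apply: (@is_derive_glue R (fun s : R => - (s ^+ 2 - 3 * s + 3) : R) (fun s : R => - s^-1 : R)
  (fun s : R => 3 - 2 * s : R) (fun s : R => (s ^+ 2)^-1 : R) 1) => [x _|x x1||].
- by apply: is_derive_eq; rewrite /GRing.scale /=; ring.
- have x0 : x != 0 by rewrite gt_eqF // (lt_le_trans _ x1).
  have dV : is_derive x (1 : R) (fun y => y^-1 : R) (- x ^- 2 *: 1).
    exact: is_deriveV.
  by apply: is_derive_eq; rewrite /GRing.scale /= mulr1 opprK.
- by rewrite invr1; ring.
- by rewrite expr1n invr1; ring.
Qed.

Lemma continuous_prof2 (R : realType) : continuous (@prof2 R).
Proof.
apply: (@continuous_glue R (fun s : R => 3 - 2 * s : R) (fun s : R => (s ^+ 2)^-1 : R) 1) => [x _|x x1|].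
- by apply: cvgB; [exact: cvg_cst|apply: cvgMr; exact: cvg_id].
- have x0 : x != 0 by rewrite gt_eqF // (lt_le_trans _ x1).
  by apply: cvgV; [rewrite sqrf_eq0|exact: exprn_continuous].
- by rewrite expr1n invr1; ring.
Qed.

Lemma is_derive_cap (R : realType) (s : R) : is_derive s (1 : R) (@cap R) (cap1 s).
Proof.
apply: (@is_derive_glue R (fun s : R => (1 - s) ^+ 2 : R) (fun s : R => 0 : R)
  (fun s : R => - 2 * (1 - s) : R) (fun s : R => 0 : R) 1).
- by move=> x _; apply: is_derive_eq; rewrite /GRing.scale /=; ring.
- by rewrite subrr expr0n.
- by rewrite subrr mulr0.
Qed.

Lemma continuous_cap1 (R : realType) : continuous (@cap1 R).
Proof.
apply: (@continuous_glue R (fun s : R => - 2 * (1 - s) : R) (fun s : R => 0 : R) 1) => [x _|x x1|].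
- by apply: cvgMr; apply: cvgB; [exact: cvg_cst|exact: cvg_id].
- exact: cvg_cst.
- by ring.
Qed.

Lemma is_derive_continuous (R : realType) (f f1 : R -> R) :
  (forall x : R, is_derive x (1 : R) f (f1 x)) -> continuous f.
Proof.
move=> df x; apply: differentiable_continuous; apply/derivable1_diffP.
by have [] := df x.
Qed.

Definition rsq (R : realType) (a r : R) (x : R * R) : R :=
  ((x.1 - a) ^+ 2 + x.2 ^+ 2) / r ^+ 2.

Lemma continuous_fstR (R : realType) : continuous (fun x : R * R => x.1).
Proof.
move=> x P /nbhs_ballP[e e0 h]; apply/nbhs_ballP; exists e => // y [y1 _]; exact: h.
Qed.

Lemma continuous_sndR (R : realType) : continuous (fun x : R * R => x.2).
Proof.
move=> x P /nbhs_ballP[e e0 h]; apply/nbhs_ballP; exists e => // y [_ y1]; exact: h.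
Qed.

Lemma continuous_x1B (R : realType) (a : R) : continuous (fun x : R * R => x.1 - a).
Proof. by move=> x; apply: cvgB; [exact: continuous_fstR|exact: cvg_cst]. Qed.

Lemma continuous_rsq (R : realType) (a r : R) : continuous (@rsq R a r).
Proof.
move=> x; apply: cvgMl; apply: cvgD.
- apply: (@cvg_comp _ _ _ (fun x : R * R => x.1 - a) (fun t => t ^+ 2)).
    exact: continuous_x1B.
  exact: exprn_continuous.
- apply: (@cvg_comp _ _ _ (fun x : R * R => x.2) (fun t => t ^+ 2)).
    exact: continuous_sndR.
  exact: exprn_continuous.
Qed.

Lemma continuous_comp_rsq (R : realType) (p : R -> R) (a r : R) :
  continuous p -> continuous (fun x => p (rsq a r x)).
Proof.
by move=> cp x; apply: (@cvg_comp _ _ _ (rsq a r) p); [exact: continuous_rsq|exact: cp].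
Qed.

Lemma is_derive_rsq1 (R : realType) (p p1 : R -> R) (a r x y : R) :
  (forall s : R, is_derive s (1 : R) p (p1 s)) ->
  is_derive x (1 : R) (fun t => p (rsq a r (t, y)))
    (2 * (x - a) / r ^+ 2 * p1 (rsq a r (x, y))).
Proof.
move=> dp; have ds : is_derive x (1 : R) (fun t => rsq a r (t, y)) (2 * (x - a) / r ^+ 2).
  by rewrite /rsq /=; apply: is_derive_eq; rewrite /GRing.scale /=; ring.
have dps := dp (rsq a r (x, y)).
have := @is_derive1_comp R p (fun t => rsq a r (t, y)) x _ _ dps ds.
by rewrite mulrC.
Qed.

Lemma is_derive_rsq2 (R : realType) (p p1 : R -> R) (a r x y : R) :
  (forall s : R, is_derive s (1 : R) p (p1 s)) ->
  is_derive y (1 : R) (fun t => p (rsq a r (x, t)))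
    (2 * y / r ^+ 2 * p1 (rsq a r (x, y))).
Proof.
move=> dp; have ds : is_derive y (1 : R) (fun t => rsq a r (x, t)) (2 * y / r ^+ 2).
  by rewrite /rsq /=; apply: is_derive_eq; rewrite /GRing.scale /=; ring.
have dps := dp (rsq a r (x, y)).
have := @is_derive1_comp R p (fun t => rsq a r (x, t)) y _ _ dps ds.
by rewrite mulrC.
Qed.

(** The constant [ln (r ^+ 2)] makes potentials of different radii agree far away. *)
Definition pot (R : realType) (a r : R) (x : R * R) : R :=
  prof (rsq a r x) - ln (r ^+ 2).
Definition pot1 (R : realType) (a r : R) (x : R * R) : R :=
  2 * (x.1 - a) / r ^+ 2 * prof1 (rsq a r x).
Definition pot2 (R : realType) (a r : R) (x : R * R) : R :=
  2 * x.2 / r ^+ 2 * prof1 (rsq a r x).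
Definition pot11 (R : realType) (a r : R) (x : R * R) : R :=
  2 / r ^+ 2 * prof1 (rsq a r x) + (2 * (x.1 - a) / r ^+ 2) ^+ 2 * prof2 (rsq a r x).
Definition pot22 (R : realType) (a r : R) (x : R * R) : R :=
  2 / r ^+ 2 * prof1 (rsq a r x) + (2 * x.2 / r ^+ 2) ^+ 2 * prof2 (rsq a r x).
Definition bump (R : realType) (a r : R) (x : R * R) : R :=
  12 / r ^+ 2 * cap (rsq a r x).
Definition bump1 (R : realType) (a r : R) (x : R * R) : R :=
  12 / r ^+ 2 * (2 * (x.1 - a) / r ^+ 2 * cap1 (rsq a r x)).

(** In the variable [s = rsq a r x] the operator [- Lap] becomes
    [- 4 / r ^+ 2 * (prof1 s + s * prof2 s)]. This is [12 / r ^+ 2 * (1 - s) ^+ 2] inside the disc,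
    and 0 outside, where the logarithm is harmonic. *)
Lemma bumpE (R : realType) (a r : R) (x : R * R) : 0 < r ->
  bump a r x = - (pot11 a r x + pot22 a r x).
Proof.
move=> r0; have rn : r != 0 by rewrite gt_eqF.
have E : (2 * (x.1 - a) / r ^+ 2) ^+ 2 + (2 * x.2 / r ^+ 2) ^+ 2 =
    4 / r ^+ 2 * rsq a r x by rewrite /rsq; field.
have -> : pot11 a r x + pot22 a r x = 4 / r ^+ 2 * prof1 (rsq a r x) +
    4 / r ^+ 2 * rsq a r x * prof2 (rsq a r x).
  by rewrite -E /pot11 /pot22; field.
rewrite /bump /cap /prof1 /prof2; case: leP => s1; first by field.
have sn : rsq a r x != 0 by rewrite gt_eqF // (lt_trans _ s1).
by field; rewrite sn.
Qed.

Lemma is_derive_pot_1 (R : realType) (a r x y : R) :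
  is_derive x (1 : R) (fun t => pot a r (t, y)) (pot1 a r (x, y)).
Proof.
have d := is_derive_rsq1 a r x y (@is_derive_prof R).
by rewrite /pot; apply: is_derive_eq; rewrite subr0.
Qed.

Lemma is_derive_pot_2 (R : realType) (a r x y : R) :
  is_derive y (1 : R) (fun t => pot a r (x, t)) (pot2 a r (x, y)).
Proof.
have d := is_derive_rsq2 a r x y (@is_derive_prof R).
by rewrite /pot; apply: is_derive_eq; rewrite subr0.
Qed.

Lemma is_derive_pot1_1 (R : realType) (a r x y : R) :
  is_derive x (1 : R) (fun t => pot1 a r (t, y)) (pot11 a r (x, y)).
Proof.
have d := is_derive_rsq1 a r x y (@is_derive_prof1 R).
by rewrite /pot1 /pot11; apply: is_derive_eq; rewrite /GRing.scale /=; ring.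
Qed.

Lemma is_derive_pot2_2 (R : realType) (a r x y : R) :
  is_derive y (1 : R) (fun t => pot2 a r (x, t)) (pot22 a r (x, y)).
Proof.
have d := is_derive_rsq2 a r x y (@is_derive_prof1 R).
by rewrite /pot2 /pot22; apply: is_derive_eq; rewrite /GRing.scale /=; ring.
Qed.

Lemma is_derive_bump_1 (R : realType) (a r x y : R) :
  is_derive x (1 : R) (fun t => bump a r (t, y)) (bump1 a r (x, y)).
Proof.
have d := is_derive_rsq1 a r x y (@is_derive_cap R).
by rewrite /bump /bump1; apply: is_derive_eq; rewrite /GRing.scale /=; ring.
Qed.

Lemma continuous_prof (R : realType) : continuous (@prof R).
Proof. exact: is_derive_continuous (@is_derive_prof R). Qed.

Lemma continuous_prof1 (R : realType) : continuous (@prof1 R).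
Proof. exact: is_derive_continuous (@is_derive_prof1 R). Qed.

Lemma continuous_x1scale (R : realType) (a k : R) :
  continuous (fun x : R * R => 2 * (x.1 - a) / k).
Proof. by move=> x; apply: cvgMl; apply: cvgMr; exact: continuous_x1B. Qed.

Lemma continuous_x2scale (R : realType) (k : R) :
  continuous (fun x : R * R => 2 * x.2 / k).
Proof. by move=> x; apply: cvgMl; apply: cvgMr; exact: continuous_sndR. Qed.

Lemma continuous_pot (R : realType) (a r : R) : continuous (@pot R a r).
Proof.
move=> x; apply: cvgB; last exact: cvg_cst.
exact: (continuous_comp_rsq (@continuous_prof R)).
Qed.

Lemma continuous_pot1 (R : realType) (a r : R) : continuous (@pot1 R a r).
Proof.
move=> x; apply: cvgM; first exact: continuous_x1scale.
exact: (continuous_comp_rsq (@continuous_prof1 R)).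
Qed.

Lemma continuous_pot2 (R : realType) (a r : R) : continuous (@pot2 R a r).
Proof.
move=> x; apply: cvgM; first exact: continuous_x2scale.
exact: (continuous_comp_rsq (@continuous_prof1 R)).
Qed.

Lemma continuous_sqr (R : realType) (h : R * R -> R) :
  continuous h -> continuous (fun x => h x ^+ 2).
Proof.
move=> ch x; apply: (@cvg_comp _ _ _ h (fun t => t ^+ 2)); first exact: ch.
exact: exprn_continuous.
Qed.

Lemma continuous_pot11 (R : realType) (a r : R) : continuous (@pot11 R a r).
Proof.
move=> x; apply: cvgD.
  by apply: cvgMr; exact: (continuous_comp_rsq (@continuous_prof1 R)).
apply: cvgM; last exact: (continuous_comp_rsq (@continuous_prof2 R)).
exact: (continuous_sqr (@continuous_x1scale R a _)).
Qed.

Lemma continuous_pot22 (R : realType) (a r : R) : continuous (@pot22 R a r).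
Proof.
move=> x; apply: cvgD.
  by apply: cvgMr; exact: (continuous_comp_rsq (@continuous_prof1 R)).
apply: cvgM; last exact: (continuous_comp_rsq (@continuous_prof2 R)).
exact: (continuous_sqr (@continuous_x2scale R _)).
Qed.

Lemma continuous_bump (R : realType) (a r : R) : continuous (@bump R a r).
Proof.
move=> x; apply: cvgMr; apply: (continuous_comp_rsq).
exact: is_derive_continuous (@is_derive_cap R).
Qed.

Lemma continuous_bump1 (R : realType) (a r : R) : continuous (@bump1 R a r).
Proof.
move=> x; apply: cvgMr; apply: cvgM; first exact: continuous_x1scale.
exact: (continuous_comp_rsq (@continuous_cap1 R)).
Qed.

Lemma rsq_ge0 (R : realType) (a r : R) (x : R * R) : 0 <= rsq a r x.
Proof. by rewrite /rsq divr_ge0 ?sqr_ge0 // addr_ge0 ?sqr_ge0. Qed.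

Lemma rsq_gt1 (R : realType) (a r : R) (x : R * R) : 0 < r ->
  ~ cbox (a, 0) r x -> 1 < rsq a r x.
Proof.
move=> r0 xb; rewrite /rsq ltr_pdivlMr ?exprn_gt0 // mul1r ltNge; apply/negP => h.
have h1 := sqr_ge0 (x.1 - a); have h2 := sqr_ge0 x.2.
apply: xb; split => /=; rewrite ?subr0 -ler_sqr ?nnegrE ?(ltW r0) // real_normK ?num_real //; lra.
Qed.

Lemma pot_far (R : realType) (a r : R) (x : R * R) : 0 < r -> 1 < rsq a r x ->
  let s := (x.1 - a) ^+ 2 + x.2 ^+ 2 in
  [/\ 0 < s, pot a r x = - ln s, pot1 a r x = - (2 * (x.1 - a) / s),
    pot2 a r x = - (2 * x.2 / s) &
    pot11 a r x = 2 * ((x.1 - a) ^+ 2 - x.2 ^+ 2) / s ^+ 2 /\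
    pot22 a r x = 2 * (x.2 ^+ 2 - (x.1 - a) ^+ 2) / s ^+ 2].
Proof.
move=> r0 s1 s; have r20 : 0 < r ^+ 2 by rewrite exprn_gt0.
have s0 : 0 < s by move: s1; rewrite /rsq ltr_pdivlMr // mul1r; apply: lt_trans.
have rn : r != 0 by rewrite gt_eqF.
have sn : s != 0 by rewrite gt_eqF.
have n1 : (rsq a r x <= 1) = false by rewrite leNgt s1.
rewrite /pot /pot1 /pot2 /pot11 /pot22 /prof /prof1 /prof2 !n1 /rsq -/s.
split => //.
- by rewrite ln_div ?posrE // opprB addrAC subrr add0r.
- by field; rewrite sn.
- by field; rewrite sn.
- split; rewrite /s in sn *; field; by rewrite sn.
Qed.

Lemma cbox_shift (R : realType) (a r M : R) (x : R * R) : `|a| + r <= M ->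
  ~ cbox (0, 0) M x -> ~ cbox (a, 0) r x.
Proof.
move=> aM xb [/= x1 x2]; apply: xb; split => /=; rewrite subr0.
- rewrite -(subrK a x.1) (le_trans (ler_normD _ _)) // (le_trans _ aM) //.
  by rewrite addrC lerD2l.
- by move: x2; rewrite subr0 => /le_trans; apply; apply: le_trans aM; rewrite lerDr.
Qed.

Lemma bump_ge0 (R : realType) (a r : R) (x : R * R) : 0 <= bump a r x.
Proof.
rewrite /bump mulr_ge0 ?divr_ge0 ?sqr_ge0 // /cap; case: ifP => // _; exact: sqr_ge0.
Qed.

Lemma bump_le (R : realType) (a r : R) (x : R * R) : bump a r x <= 12 / r ^+ 2.
Proof.
have c1 : cap (rsq a r x) <= 1.
  have s0 := rsq_ge0 a r x; rewrite /cap; case: (leP (rsq a r x) 1) => s1; last exact: ler01.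
  nra.
by rewrite /bump ler_piMr // divr_ge0 // sqr_ge0.
Qed.

Lemma bump_out (R : realType) (a r : R) (x : R * R) : 0 < r ->
  ~ cbox (a, 0) r x -> bump a r x = 0.
Proof. by move=> r0 /(rsq_gt1 r0) s1; rewrite /bump /cap leNgt s1 mulr0. Qed.

Lemma bump1_out (R : realType) (a r : R) (x : R * R) : 0 < r ->
  ~ cbox (a, 0) r x -> bump1 a r x = 0.
Proof. by move=> r0 /(rsq_gt1 r0) s1; rewrite /bump1 /cap1 leNgt s1 !mulr0. Qed.

Lemma rsq_le1_norm (R : realType) (a r : R) (x : R * R) : 0 < r ->
  rsq a r x <= 1 -> `|x.1 - a| <= r /\ `|x.2| <= r.
Proof.
move=> r0 s1; have [[/= h1 h2]|h] := pselect (cbox (a, 0) r x).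
  by move: h2; rewrite subr0.
by have := rsq_gt1 r0 h; rewrite ltNge s1.
Qed.

Lemma bump1_le (R : realType) (a r : R) (x : R * R) : 0 < r ->
  `|bump1 a r x| <= 48 / r ^+ 3.
Proof.
move=> r0; rewrite /bump1 /cap1; case: (leP (rsq a r x) 1) => s1; last first.
  by rewrite !mulr0 normr0 divr_ge0 // exprn_ge0 // ltW.
have [x1 _] := rsq_le1_norm r0 s1; have s0 := rsq_ge0 a r x.
have rn : r != 0 by rewrite gt_eqF.
set s := rsq a r x in s0 s1 *.
have -> : 12 / r ^+ 2 * (2 * (x.1 - a) / r ^+ 2 * (- 2 * (1 - s))) =
  - (48 / r ^+ 4 * ((x.1 - a) * (1 - s))) by field.
have -> : 48 / r ^+ 3 = 48 / r ^+ 4 * (r * 1) by field.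
have k0 : 0 <= 48 / r ^+ 4 by rewrite divr_ge0 // exprn_ge0 // ltW.
rewrite normrN normrM (ger0_norm k0) ler_wpM2l // normrM ler_pM //.
by rewrite ger0_norm; lra.
Qed.

(** Inside the disc [prof1] and [prof2] are at most 3 in absolute value and the squared gradient
    factor is at most [4 / r ^+ 2], whence [18 = 2 * 3 + 4 * 3]. Outside, the point-mass kernel is
    at most 2 over the squared distance. *)
Lemma pot11_le (R : realType) (a r : R) (x : R * R) : 0 < r ->
  `|pot11 a r x| <= 18 / r ^+ 2.
Proof.
move=> r0; have r2 : 0 < r ^+ 2 by rewrite exprn_gt0.
have h1 := sqr_ge0 (x.1 - a); have h2 := sqr_ge0 x.2; have s0 := rsq_ge0 a r x.
have [s1|s1] := leP (rsq a r x) 1.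
  rewrite /pot11 /prof1 /prof2 s1; set s := rsq a r x in s0 s1 *.
  have xs : (2 * (x.1 - a) / r ^+ 2) ^+ 2 <= 4 / r ^+ 2.
    have -> : (2 * (x.1 - a) / r ^+ 2) ^+ 2 = 4 / r ^+ 2 * ((x.1 - a) ^+ 2 / r ^+ 2).
      by field; rewrite gt_eqF.
    have k0 : 0 <= 4 / r ^+ 2 by rewrite divr_ge0 // ltW.
    rewrite ler_piMr //; apply: le_trans s1; rewrite /s /rsq.
    by rewrite ler_wpM2r // ?invr_ge0 ?lerDl // ltW.
  have -> : 18 / r ^+ 2 = 2 / r ^+ 2 * 3 + 4 / r ^+ 2 * 3 by field; rewrite gt_eqF.
  have k0 : 0 <= 2 / r ^+ 2 by rewrite divr_ge0 // ltW.
  have q0 := sqr_ge0 (2 * (x.1 - a) / r ^+ 2).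
  apply: le_trans (ler_normD _ _) _; apply: lerD.
  - rewrite normrM (ger0_norm k0); apply: ler_wpM2l => //.
    by rewrite normrN ger0_norm; nra.
  - by rewrite normrM (ger0_norm q0); apply: ler_pM => //; rewrite ger0_norm; lra.
have [p0 _ _ _ [-> _]] := pot_far r0 s1.
move: s1; rewrite /rsq ltr_pdivlMr // mul1r => s1.
set s := _ + x.2 ^+ 2 in p0 s1 *.
have s20 : 0 < s ^+ 2 by rewrite exprn_gt0.
apply: (@le_trans _ _ (2 / s)).
  rewrite !normrM normfV (gtr0_norm s20) ger0_norm // ler_pdivrMr //.
  rewrite -mulrA ler_wpM2l // -[s ^+ 2]/(s * s) mulKf ?gt_eqF //.
  by rewrite ler_norml /s; lra.
rewrite ler_pdivrMr // mulrAC ler_pdivlMr //; lra.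
Qed.

(** * The transform of a single bump *)

Lemma pairing_bump_sub (R : realType) (phi : R * R -> R) (c M a r1 r2 : R) :
  continuous phi -> (forall x, `|phi x| <= M) ->
  (leb2 R).-integrable setT (EFin \o phi) ->
  L1 (ft_cos phi) -> L1 (ft_sin phi) -> 0 < r1 -> 0 < r2 ->
  pairing (@R1sq_symbol R) phi c (fun x => bump a r1 x - bump a r2 x) =
  cos c * (4 * pi ^+ 2) *
    Rintegral (leb2 R) setT (fun x => (pot11 a r1 x - pot11 a r2 x) * phi x).
Proof.
move=> cphi phiM phii LC LS r10 r20.
pose D (u : R -> R -> R * R -> R) x := u a r1 x - u a r2 x.
have cD u : (forall r, continuous (u a r)) -> continuous (D u).
  by move=> cu x; apply: cvgB; exact: cu.
have dB1 (u u1 : R -> R -> R * R -> R) x y :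
    (forall r, is_derive x (1 : R) (fun t => u a r (t, y)) (u1 a r (x, y))) ->
    is_derive x (1 : R) (fun t => D u (t, y)) (D u1 (x, y)).
  by move=> d; have d1 := d r1; have d2 := d r2; exact: is_deriveB.
have dB2 (u u1 : R -> R -> R * R -> R) x y :
    (forall r, is_derive y (1 : R) (fun t => u a r (x, t)) (u1 a r (x, y))) ->
    is_derive y (1 : R) (fun t => D u (x, t)) (D u1 (x, y)).
  by move=> d; have d1 := d r1; have d2 := d r2; exact: is_deriveB.
rewrite (_ : (fun x => _ - _) = fun x => - (D (@pot11 R) x + D (@pot22 R) x)); last first.
  by apply/funext => x; rewrite !bumpE // /D; ring.
(* The box contains both discs; outside of it the two potentials are the same logarithm, and so are
   their derivatives. *)
apply: (@pairing_laplacian R phi (D (@pot R)) (D (@pot1 R)) (D (@pot11 R))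
  (D (@pot2 R)) (D (@pot22 R)) c M (`|a| + (r1 + r2)) cphi phiM phii LC LS).
- by apply: cD => r; exact: continuous_pot.
- by apply: cD => r; exact: continuous_pot1.
- by apply: cD => r; exact: continuous_pot11.
- by apply: cD => r; exact: continuous_pot2.
- by apply: cD => r; exact: continuous_pot22.
- by move=> x y; apply: dB1 => r; exact: is_derive_pot_1.
- by move=> x y; apply: dB1 => r; exact: is_derive_pot1_1.
- by move=> x y; apply: dB2 => r; exact: is_derive_pot_2.
- by move=> x y; apply: dB2 => r; exact: is_derive_pot2_2.
- move=> x xb.
  have b1 : ~ cbox (a, 0) r1 x by apply: cbox_shift xb; rewrite lerD2l lerDl ltW.
  have b2 : ~ cbox (a, 0) r2 x by apply: cbox_shift xb; rewrite lerD2l lerDr ltW.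
  have [_ e1 e2 e3 [e4 e5]] := pot_far r10 (rsq_gt1 r10 b1).
  have [_ f1 f2 f3 [f4 f5]] := pot_far r20 (rsq_gt1 r20 b2).
  by rewrite /D e1 e2 e3 e4 e5 f1 f2 f3 f4 f5 !subrr.
Qed.

(** The bound, uniform in the radius, is the maximum [12 / r ^+ 2] times the area of the enclosing
    square. *)
Lemma integrable_bump (R : realType) (a r : R) : 0 < r ->
  (leb2 R).-integrable setT (EFin \o bump a r) /\
  Rintegral (leb2 R) setT (fun x => `|bump a r x|) <= 48.
Proof.
move=> r0.
have [|||i b] := @integrable_bounded_cbox R (bump a r) (a, 0) r (12 / r ^+ 2) (ltW r0).
- by apply: continuous_measurable_fun2; exact: continuous_bump.
- by move=> x; rewrite ger0_norm ?bump_ge0 // bump_le.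
- by move=> x; exact: bump_out.
split => //; apply: le_trans b _.
have -> : 12 / r ^+ 2 * (4 * r ^+ 2) = 48 by field; rewrite gt_eqF.
by [].
Qed.

(** One integration by parts trades the bump for its derivative, whose L^1 norm is at most [192 / r]
    by scaling, against a division by [xi.1]. The line [xi.1 = 0] is harmless later because the
    symbol vanishes on it. *)
Lemma ft_phase_bump_cvg0 (R : realType) (a c : R) (xi : R * R) : xi.1 != 0 ->
  ft_phase c (bump a n.+1%:R) xi @[n --> \oo] --> 0.
Proof.
move=> x0; apply: (@cvg_of_harmonic_bound R _ _ (192 / `|xi.1|)) => n.
have n0 : 0 < n.+1%:R :> R by rewrite ltr0n.
set r := n.+1%:R in n0 *; rewrite subr0.
have sh u : (forall x, ~ cbox (a, 0) r x -> u x = 0) ->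
    forall x, ~ cbox (0, 0) (`|a| + r) x -> u x = 0 :> R.
  by move=> h x xb; apply: h; exact: cbox_shift xb.
(* The phase starts at [c + pi / 2] so that the quarter turn brings it back to [c]. *)
have := @ft_phase_derive1 R (bump a r) (bump1 a r) (`|a| + r) (c + pi / 2) xi
  (@continuous_bump R a r) (@continuous_bump1 R a r) (@is_derive_bump_1 R a r)
  (sh _ (fun x => bump_out n0)) (sh _ (fun x => bump1_out n0)).
rewrite addrK => E.
have -> : ft_phase c (bump a r) xi = ft_phase (c + pi / 2) (bump1 a r) xi / xi.1.
  by rewrite E mulrAC divff // mul1r.
have [|||i b] := @integrable_bounded_cbox R (bump1 a r) (a, 0) r (48 / r ^+ 3) (ltW n0).
- by apply: continuous_measurable_fun2; exact: continuous_bump1.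
- by move=> x; exact: bump1_le.
- by move=> x; exact: bump1_out.
rewrite normrM normfV [leRHS]mulrAC ler_wpM2r ?invr_ge0 //.
apply: le_trans (ft_phase_bound _ xi i) _; apply: le_trans b _.
by have -> : 48 / r ^+ 3 * (4 * r ^+ 2) = 192 / r by field; rewrite gt_eqF.
Qed.

Lemma pairing_bump_cvg0 (R : realType) (phi : R * R -> R) (c a : R) :
  L1 (ft_cos phi) -> L1 (ft_sin phi) ->
  pairing (@R1sq_symbol R) phi c (bump a n.+1%:R) @[n --> \oo] --> 0.
Proof.
move=> LC LS; have [mC Ci] := LC; have [mS Si] := LS.
have -> : 0 = Rintegral (leb2 R) setT (fun=> 0) :> R.
  by rewrite Rintegral_cst // mul0r.
have n0 n : 0 < n.+1%:R :> R by rewrite ltr0n.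
apply: (@dominated_Rintegral _ _ R (leb2 R) setT (fun n xi => R1sq_symbol xi *
  (ft_phase c (bump a n.+1%:R) xi * ft_cos phi xi +
   ft_phase (c - pi / 2) (bump a n.+1%:R) xi * ft_sin phi xi)) (fun=> 0)
  (fun xi => 48 * (`|ft_cos phi xi| + `|ft_sin phi xi|))) => //.
- move=> n; apply: measurable_funM; first exact: measurable_R1sq_symbol.
  have ib := (integrable_bump a (n0 n)).1.
  by apply: measurable_funD; apply: measurable_funM => //; exact: measurable_ft_phase.
- by apply: integrable_scale; apply: integrable_add2; exact: integrable_norm.
- move=> n xi _; have [ib b48] := integrable_bump a (n0 n).
  rewrite normrM; apply: le_trans (_ : 1 * _ <= _).
    by apply: ler_wpM2r => //; exact: R1sq_symbol_le1.
  rewrite mul1r (le_trans (ler_normD _ _)) // !normrM mulrDr.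
  by apply: lerD; apply: ler_wpM2r => //; apply: le_trans b48; exact: ft_phase_bound.
- apply: aeW => xi _; have [x0|x0] := eqVneq xi.1 0.
    rewrite (_ : (fun n => _) = fun=> 0); first exact: cvg_cst.
    by apply/funext => n; rewrite /R1sq_symbol x0 expr0n oppr0 !mul0r.
  rewrite -[X in _ --> X](mulr0 (R1sq_symbol xi)); apply: cvgMr.
  rewrite -[X in _ --> X]addr0; apply: cvgD.
  + rewrite -[X in _ --> X](mul0r (ft_cos phi xi)); apply: cvgMl.
    exact: ft_phase_bump_cvg0.
  + rewrite -[X in _ --> X](mul0r (ft_sin phi xi)); apply: cvgMl.
    exact: ft_phase_bump_cvg0.
Qed.

Lemma pot11_Rintegral_cvg0 (R : realType) (phi : R * R -> R) (a : R) :
  (leb2 R).-integrable setT (EFin \o phi) ->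
  Rintegral (leb2 R) setT (fun x => pot11 a n.+1%:R x * phi x) @[n --> \oo] --> 0.
Proof.
move=> phii.
have mphi : measurable_fun setT phi by apply/measurable_EFinP; exact: measurable_int phii.
apply: (@cvg_of_harmonic_bound R _ _
  (18 * Rintegral (leb2 R) setT (fun x => `|phi x|))) => n.
have n0 : 0 < n.+1%:R :> R by rewrite ltr0n.
have ni := integrable_norm phii.
rewrite subr0 -mulrA [_ * n.+1%:R^-1]mulrC mulrA -RintegralZl //.
apply: le_normr_Rintegral_dom => //.
- apply: measurable_funM => //; apply: continuous_measurable_fun2.
  exact: continuous_pot11.
- exact: integrable_scale.
- move=> x _; rewrite normrM ler_wpM2r // (le_trans (pot11_le _ _ n0)) //.
  rewrite ler_wpM2l // lef_pV2 ?posrE ?exprn_gt0 //.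
  by rewrite ler_eXnr // ler1n.
Qed.

(** The discrepancy between the two sides is the same for all radii, by [pairing_bump_sub]. Along
    the radii [n.+1] each of its two terms tends to 0, so it is 0. *)
Lemma pairing_bump (R : realType) (phi : R * R -> R) (c M a r : R) :
  continuous phi -> (forall x, `|phi x| <= M) ->
  (leb2 R).-integrable setT (EFin \o phi) ->
  L1 (ft_cos phi) -> L1 (ft_sin phi) -> 0 < r ->
  pairing (@R1sq_symbol R) phi c (bump a r) =
  cos c * (4 * pi ^+ 2) * Rintegral (leb2 R) setT (fun x => pot11 a r x * phi x).
Proof.
move=> cphi phiM phii LC LS r0.
have mm := @measurable_R1sq_symbol R; have m1 := @R1sq_symbol_le1 R.
have [P hP] := dual_pot_bounded c mm m1 LC LS.
have mP := measurable_dual_pot c mm m1 LC LS.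
have iP s : 0 < s -> (leb2 R).-integrable setT
    (EFin \o (fun y => bump a s y * dual_pot (@R1sq_symbol R) phi c y)).
  move=> s0; apply: (@integrableMr_bounded _ _ _ _ _ _ _ P) => //.
  exact: (integrable_bump a s0).1.
have ig s : 0 < s -> (leb2 R).-integrable setT (EFin \o (fun x => pot11 a s x * phi x)).
  move=> s0; apply: integrable_mul_bounded (fun x => pot11_le a x s0) phii.
  by apply: continuous_measurable_fun2; exact: continuous_pot11.
have n0 n : 0 < n.+1%:R :> R by rewrite ltr0n.
pose k := cos c * (4 * pi ^+ 2).
have E n : pairing (@R1sq_symbol R) phi c (bump a r) -
    k * Rintegral (leb2 R) setT (fun x => pot11 a r x * phi x) =
    pairing (@R1sq_symbol R) phi c (bump a n.+1%:R) -
    k * Rintegral (leb2 R) setT (fun x => pot11 a n.+1%:R x * phi x).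
  have := pairing_bump_sub c a cphi phiM phii LC LS r0 (n0 n).
  have [i1 _] := integrable_bump a r0; have [i2 _] := integrable_bump a (n0 n).
  rewrite !pairing_swap //; last first.
    by have := integrable_add2 i1 (integrable_scale (-1) i2); congr integrable;
      apply/funext => x /=; rewrite mulN1r.
  under eq_Rintegral do rewrite mulrBl.
  rewrite RintegralB //; [|exact: iP|exact: iP].
  under [in RHS]eq_Rintegral do rewrite mulrBl.
  rewrite RintegralB //; [|exact: ig|exact: ig].
  by rewrite -/k; lra.
apply/eqP; rewrite -subr_eq0; apply/eqP; rewrite -/k.
have L : pairing (@R1sq_symbol R) phi c (bump a n.+1%:R) -
    k * Rintegral (leb2 R) setT (fun x => pot11 a n.+1%:R x * phi x) @[n --> \oo] --> 0.
  rewrite -[X in _ --> X]subr0 -[X in _ - X](mulr0 k); apply: cvgB.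
    exact: pairing_bump_cvg0.
  by apply: cvgMr; exact: pot11_Rintegral_cvg0.
rewrite -(funext E) in L.
exact: (cvg_unique (@Rhausdorff R) (cvg_cst _) L).
Qed.

(** * Series of functions *)

(** The upper limit makes the sum measurable everywhere; its value is meaningful
    only where the series converges. *)
Definition fser (T : Type) (R : realType) (h : nat -> T -> R) (x : T) : R :=
  fine (limn_esup (fun n => (\sum_(0 <= k < n) h k x)%:E)).

Lemma measurable_fser d (T : measurableType d) (R : realType) (h : nat -> T -> R) :
  (forall k, measurable_fun setT (h k)) -> measurable_fun setT (fser h).
Proof.
move=> mh; apply: measurableT_comp => //.
apply: measurable_fun_limn_esup => n; apply/measurable_EFinP.
exact: measurable_sum.
Qed.

Lemma fser_cvg (T : Type) (R : realType) (h : nat -> T -> R) (x : T) (l : R) :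
  \sum_(0 <= k < n) h k x @[n --> \oo] --> l -> fser h x = l.
Proof.
move=> hl; rewrite /fser.
have : (\sum_(0 <= k < n) h k x)%:E @[n --> \oo] --> l%:E.
  by apply: cvg_EFin; [exact: nearW|exact: hl].
by move=> /cvg_limn_einf_sup[_ ->].
Qed.

(** No convergence is required: an upper limit of eventually nonnegative sums is nonnegative, and
    [fine] sends an infinite value to 0. *)
Lemma fser_ge0 (T : Type) (R : realType) (h : nat -> T -> R) (x : T) (N : nat) :
  (forall n, (N <= n)%N -> 0 <= \sum_(0 <= k < n) h k x) -> 0 <= fser h x.
Proof.
move=> h0; apply: fine_ge0; rewrite limn_esup_lim.
apply: lime_ge; first exact: is_cvg_esups.
apply: nearW => n; apply: (@le_trans _ _ (\sum_(0 <= k < maxn n N) h k x)%:E).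
  by rewrite lee_fin h0 // leq_maxr.
by apply: ereal_sup_ubound; exists (maxn n N) => //=; rewrite leq_maxl.
Qed.

Lemma fser_summable_cvg (T : Type) (R : realType) (h : nat -> T -> R) (x : T) :
  (\sum_(k <oo) (`|h k x|)%:E < +oo)%E ->
  \sum_(0 <= k < n) h k x @[n --> \oo] --> fser h x.
Proof.
move=> hfin.
have hn : cvgn [normed series (fun k => h k x)].
  apply: nondecreasing_is_cvgn.
    by apply: (@nondecreasing_series _ (fun k => `|h k x|) xpredT 0%N).
  exists (fine (\sum_(k <oo) (`|h k x|)%:E)) => _ [n _ <-].
  rewrite -lee_fin fineK; last first.
    by rewrite ge0_fin_numE //; apply: nneseries_ge0.
  rewrite /series /= -sumEFin.
  exact: nneseries_lim_ge.
have hc := normed_cvg hn.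
by rewrite (fser_cvg (l := limn (series (fun k => h k x)))).
Qed.

(** The sum [G] of the absolute values is integrable because its integral is at most [B]. It is
    finite almost everywhere and, times a bound of [psi], dominates all partial sums; where it is
    infinite the value of [fser] is immaterial. *)
Lemma fser_integral d (T : measurableType d) (R : realType)
    (mu : {measure set T -> \bar R}) (D : set T) (h : nat -> T -> R)
    (b : nat -> R) (B : R) :
  measurable D -> (forall k, measurable_fun setT (h k)) ->
  (forall k, mu.-integrable D (EFin \o h k)) ->
  (forall k, Rintegral mu D (fun x => `|h k x|) <= b k) ->
  (forall n, \sum_(0 <= k < n) b k <= B) ->
  mu.-integrable D (EFin \o fser h) /\
  forall (psi : T -> R) (P : R), measurable_fun D psi ->
    (forall x, D x -> `|psi x| <= P) ->
    \sum_(0 <= k < n) Rintegral mu D (fun x => h k x * psi x) @[n --> \oo] -->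
    Rintegral mu D (fun x => fser h x * psi x).
Proof.
move=> mD mh hi hb bB.
have mhD k : measurable_fun D (h k) by exact: measurable_funS (mh k).
pose G x := (\sum_(k <oo) (`|h k x|)%:E)%E.
have mn k : measurable_fun D (fun x => (`|h k x|)%:E).
  by apply/measurable_EFinP; exact: measurableT_comp.
have G0 x : (0 <= G x)%E by apply: nneseries_ge0.
have IG : (\int[mu]_(x in D) G x <= B%:E)%E.
  rewrite /G integral_nneseries //.
  apply: lime_le; first by apply: is_cvg_nneseries => n _ _; exact: integral_ge0.
  apply: nearW => n; apply: le_trans (_ : (\sum_(0 <= k < n) b k)%:E <= _)%E; last first.
    by rewrite lee_fin.
  rewrite -sumEFin; apply: lee_sum => k _.
  have := hb k; rewrite /Rintegral -lee_fin fineK //.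
  by apply: integrable_fin_num => //; exact: integrable_norm (hi k).
have mG : measurable_fun D G by apply: ge0_emeasurable_sum.
have iG : mu.-integrable D G.
  apply/integrableP; split => //.
  under eq_integral do rewrite gee0_abs //.
  by apply: le_lt_trans IG _; rewrite ltry.
have aeG : {ae mu, forall x, D x -> (G x < +oo)%E}.
  apply: filterS (integrable_ae mD iG) => x + Dx => /(_ Dx).
  by rewrite ge0_fin_numE.
have part n x : (`|(\sum_(0 <= k < n) h k x)%:E| <= G x)%E.
  rewrite /= (le_trans (_ : _ <= (\sum_(0 <= k < n) `|h k x|)%:E)%E) //.
    by rewrite lee_fin ler_norm_sum.
  by rewrite -sumEFin; exact: nneseries_lim_ge.
have ms n : measurable_fun D (fun x => \sum_(0 <= k < n) h k x).
  exact: measurable_sum.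
have mf : measurable_fun D (fser h) by exact: measurable_funS (measurable_fser mh).
have dom (psi : T -> R) (P : R) : measurable_fun D psi ->
    (forall x, D x -> `|psi x| <= P) ->
    mu.-integrable D (EFin \o (fun x => fser h x * psi x)) /\
    (\int[mu]_(x in D) ((\sum_(0 <= k < n) h k x) * psi x)%:E)%E @[n --> \oo] -->
    (\int[mu]_(x in D) (fser h x * psi x)%:E)%E.
  move=> mpsi psiP.
  have [|||||fi _ cv] := @dominated_convergence _ _ _ mu D mD
    (fun n x => ((\sum_(0 <= k < n) h k x) * psi x)%:E)
    (EFin \o (fun x => fser h x * psi x)) (fun x => `|P|%:E * G x)%E.
  - by move=> n; apply/measurable_EFinP; exact: measurable_funM.
  - by apply/measurable_EFinP; exact: measurable_funM.
  - apply: filterS aeG => x + Dx => /(_ Dx) Gx.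
    apply: cvg_EFin; first exact: nearW.
    by apply: cvgMl; exact: fser_summable_cvg.
  - exact: integrableZl.
  - apply: aeW => x n Dx; rewrite EFinM abseM muleC; apply: lee_pmul => //.
    by rewrite lee_fin (le_trans (psiP x Dx)) // ler_norm.
  by split.
split.
  have [||i1 _] := dom (fun=> 1) 1 => //; first by move=> x _; rewrite normr1.
  by move: i1; congr integrable; apply/funext => x /=; rewrite mulr1.
move=> psi P mpsi psiP; have [fi cv] := dom psi P mpsi psiP.
rewrite (_ : (fun n => _) = fun n =>
  Rintegral mu D (fun x => (\sum_(0 <= k < n) h k x) * psi x)); last first.
  apply/funext => n; elim: n => [|n IH].
    rewrite big_nil; under eq_Rintegral do rewrite big_nil mul0r.
    by rewrite Rintegral_cst // mul0r.
  have is_ m : mu.-integrable D (EFin \o (fun x => (\sum_(0 <= k < m) h k x) * psi x)).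
    apply: (@integrableMr_bounded _ _ _ _ _ _ _ P) => //.
    apply: (le_integrable mD _ _ iG); first exact/measurable_EFinP.
    by move=> x Dx; rewrite (gee0_abs (G0 x)); exact: part.
  rewrite big_nat_recr //= IH -RintegralD //.
    by apply: eq_Rintegral => x _; rewrite big_nat_recr //= mulrDl.
  exact: (@integrableMr_bounded _ _ _ _ _ _ _ P).
apply: fine_cvg; rewrite fineK; last exact: integrable_fin_num.
exact: cv.
Qed.

(** * Local integrability *)

(** A single majorant for both sides of the disc boundary, chosen so that it has explicit primitives
    in each variable. Since [(r + X + Y) ^+ 2 <= 3 * (r ^+ 2 + (X ^+ 2 + Y ^+ 2))], which inside the
    disc is at most [6 * r ^+ 2], the bound [18 / r ^+ 2] becomes [108 = 18 * 6]. *)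
Lemma pot11_le_dist (R : realType) (a r : R) (x : R * R) : 0 < r ->
  `|pot11 a r x| <= 108 / (r + `|x.1 - a| + `|x.2|) ^+ 2.
Proof.
move=> r0; set X := `|x.1 - a|; set Y := `|x.2|.
have X0 : 0 <= X by exact: normr_ge0.
have Y0 : 0 <= Y by exact: normr_ge0.
have d0 : 0 < (r + X + Y) ^+ 2 by rewrite exprn_gt0 // -addrA ltr_pwDl // addr_ge0.
have EX : (x.1 - a) ^+ 2 = X ^+ 2 by rewrite real_normK ?num_real.
have EY : x.2 ^+ 2 = Y ^+ 2 by rewrite real_normK ?num_real.
have r2 : 0 < r ^+ 2 by rewrite exprn_gt0.
have d3 : (r + X + Y) ^+ 2 <= 3 * (r ^+ 2 + (X ^+ 2 + Y ^+ 2)).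
  have := sqr_ge0 (r - X); have := sqr_ge0 (r - Y); have := sqr_ge0 (X - Y).
  by nra.
have [s1|s1] := leP (rsq a r x) 1.
  apply: le_trans (pot11_le a x r0) _; rewrite ler_pdivlMr // mulrAC ler_pdivrMr //.
  by move: s1; rewrite /rsq EX EY ler_pdivrMr // mul1r; lra.
have [p0 _ _ _ [-> _]] := pot_far r0 s1.
move: s1; rewrite /rsq ltr_pdivlMr // mul1r EX EY => s1; rewrite EX EY in p0.
have s20 : 0 < (X ^+ 2 + Y ^+ 2) ^+ 2 by rewrite exprn_gt0.
rewrite normrM normfV (gtr0_norm s20) ler_pdivrMr // mulrAC ler_pdivlMr //.
have XY : `|2 * (X ^+ 2 - Y ^+ 2)| <= 2 * (X ^+ 2 + Y ^+ 2).
  have := sqr_ge0 X; have := sqr_ge0 Y; rewrite ler_norml; lra.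
apply: (@le_trans _ _ (2 * (X ^+ 2 + Y ^+ 2) * (6 * (X ^+ 2 + Y ^+ 2)))).
  by apply: ler_pM => //; [exact: sqr_ge0|lra].
have := sqr_ge0 (X ^+ 2 + Y ^+ 2); lra.
Qed.

Lemma is_derive_affine_inv (R : realType) (s x : R) : s + x != 0 ->
  is_derive x (1 : R) (fun t => - (s + t)^-1) ((s + x) ^- 2).
Proof.
move=> sx0; have dV : is_derive x (1 : R) (fun t => (s + t)^-1 : R) (- (s + x) ^- 2 *: 1).
  have dd : is_derive x (1 : R) (fun t => s + t : R) 1.
    by apply: is_derive_eq; rewrite /GRing.scale /=; ring.
  exact: is_deriveV.
by apply: is_derive_eq; rewrite /GRing.scale /= mulr1 opprK.
Qed.

Lemma is_derive_affine_invN (R : realType) (s x : R) : s - x != 0 ->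
  is_derive x (1 : R) (fun t => (s - t)^-1) ((s - x) ^- 2).
Proof.
move=> sx0; have dV : is_derive x (1 : R) (fun t => (s - t)^-1 : R) (- (s - x) ^- 2 *: (-1)).
  have dd : is_derive x (1 : R) (fun t => s - t : R) (-1).
    by apply: is_derive_eq; rewrite /GRing.scale /=; ring.
  exact: is_deriveV.
by apply: is_derive_eq; rewrite /GRing.scale /= mulrN1 opprK.
Qed.

Lemma integral_inv_dist2 (R : realType) (s : R) : 0 < s ->
  (\int[@lebesgue_measure R]_y ((s + `|y|) ^- 2)%:E)%E = (2 / s)%:E.
Proof.
move=> s0; pose F (y : R) := if y <= 0 then (s - y)^-1 else - (s + y)^-1 + 2 / s.
have pos y : 0 < s + `|y| by rewrite ltr_pwDl.
have E (y : R) : (s + `|y|) ^- 2 = if y <= 0 then (s - y) ^- 2 else (s + y) ^- 2.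
  by case: leP => h; [rewrite ler0_norm|rewrite gtr0_norm].
apply: (@improper_FTC_ge0 _ (fun y => (s + `|y|) ^- 2) F).
- by move=> y; rewrite invr_ge0 exprn_ge0 // ltW.
- move=> y; apply: cvgV; first by rewrite sqrf_eq0 gt_eqF.
  apply: (@cvg_comp _ _ _ (fun y => s + `|y|) (fun t => t ^+ 2)); last exact: exprn_continuous.
  by apply: cvgD; [exact: cvg_cst|exact: norm_continuous].
- move=> y; rewrite E.
  apply: (@is_derive_glue R (fun y => (s - y)^-1) (fun y => - (s + y)^-1 + 2 / s)
    (fun y => (s - y) ^- 2) (fun y => (s + y) ^- 2)).
  + by move=> x x0; apply: is_derive_affine_invN; rewrite gt_eqF //; lra.
  + move=> x x0; have sx : s + x != 0 by rewrite gt_eqF //; lra.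
    by have d := is_derive_affine_inv sx; apply: is_derive_eq; rewrite addr0.
  + by rewrite subr0 addr0; field; rewrite gt_eqF.
  + by rewrite subr0 addr0.
- apply: (@cvg_of_harmonic_bound R _ _ 2) => n.
  have n0 : 0 < n.+1%:R :> R by rewrite ltr0n.
  have n0N : - n.+1%:R <= 0 :> R by rewrite oppr_le0 ltW.
  rewrite /F (lt_geF n0) n0N opprK; set t := n.+1%:R in n0 *.
  have h1 : 0 <= (s + t)^-1 <= t^-1.
    have st : 0 < s + t by rewrite addr_gt0.
    by rewrite invr_ge0 (ltW st) lef_pV2 ?posrE // lerDr ltW.
  have -> : - (s + t)^-1 + 2 / s - (s + t)^-1 - 2 / s = - (2 * (s + t)^-1) by ring.
  case/andP: h1 => h1 h2; rewrite normrN ger0_norm ?mulr_ge0 //.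
  exact: ler_wpM2l.
Qed.

(** A primitive of [(r + |x - a|)^-1]; the constant [- 2 * ln r] glues the branches at [a]. *)
Definition log_prim (R : realType) (a r x : R) : R :=
  if x <= a then - ln (r + a - x) else ln (r + x - a) - 2 * ln r.

Lemma is_derive_log_prim (R : realType) (a r x : R) : 0 < r ->
  is_derive x (1 : R) (log_prim a r) ((r + `|x - a|)^-1).
Proof.
move=> r0.
have -> : (r + `|x - a|)^-1 = if x <= a then (r + a - x)^-1 else (r + x - a)^-1.
  case: leP => h; [rewrite ler0_norm|rewrite gtr0_norm]; rewrite ?subr_le0 ?subr_gt0 //.
    by rewrite opprB addrA.
  by rewrite addrA.
apply: (@is_derive_glue R (fun x => - ln (r + a - x)) (fun x => ln (r + x - a) - 2 * ln r)
    (fun x => (r + a - x)^-1) (fun x => (r + x - a)^-1)).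
- move=> y ya; have y0 : 0 < r + a - y by lra.
  have dl := is_derive1_ln y0.
  have dg : is_derive y (1 : R) (fun t => r + a - t) (-1).
    by apply: is_derive_eq; rewrite /GRing.scale /=; ring.
  have dc := @is_derive1_comp R (@ln R) (fun t => r + a - t) y _ _ dl dg.
  have := is_deriveN dc.
  by move=> d; apply: (is_derive_eq d); rewrite /GRing.scale /=; ring.
- move=> y ya; have y0 : 0 < r + y - a by lra.
  have dl := is_derive1_ln y0.
  have dg : is_derive y (1 : R) (fun t => r + t - a) 1.
    by apply: is_derive_eq; rewrite /GRing.scale /=; ring.
  have dc := @is_derive1_comp R (@ln R) (fun t => r + t - a) y _ _ dl dg.
  have := is_deriveB dc (is_derive_cst (2 * ln r) y 1).
  by move=> d; apply: (is_derive_eq d); rewrite /GRing.scale /=; ring.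
- by rewrite addrK; ring.
- by rewrite addrK.
Qed.

Lemma integral_inv_dist (R : realType) (a r q : R) : 0 < r <= 1 -> `|a| <= 1 -> 1 < q ->
  (\int[@lebesgue_measure R]_(x in `[(- q)%R, q]) ((r + `|x - a|)^-1)%:E <=
    (2 * (ln (q + 2) - ln r))%:E)%E.
Proof.
move=> /andP[r0 r1]; rewrite ler_norml => /andP[a1 a2] q1.
have qq : - q < q by lra.
have cf : continuous (fun x : R => (r + `|x - a|)^-1).
  move=> x; apply: cvgV; first by rewrite gt_eqF // ltr_pwDl.
  apply: cvgD; first exact: cvg_cst.
  apply: (@cvg_comp _ _ _ (fun x => x - a) (fun t => `|t|)); last exact: norm_continuous.
  by apply: cvgB; [exact: cvg_id|exact: cvg_cst].
rewrite (integral_FTC qq cf (fun x => is_derive_log_prim a x r0)).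
rewrite lee_fin /log_prim ifF; last by apply/negbTE; rewrite -ltNge; lra.
rewrite ifT; last by lra.
rewrite opprK; have l1 : ln (r + q - a) <= ln (q + 2).
  by rewrite ler_ln ?posrE; lra.
have l2 : ln (r + a + q) <= ln (q + 2) by rewrite ler_ln ?posrE; lra.
by rewrite opprK; lra.
Qed.

(** Inverse-square decay is critical in the plane, so the local L^1 norm is only logarithmic in [r].
    The majorant is integrated in [x.2] over the whole line, giving [216 / (r + |x.1 - a|)], and
    then in [x.1] over the interval, which gives another factor 2. *)
Lemma pot11_box_integral (R : realType) (a r q : R) : 0 < r <= 1 -> `|a| <= 1 -> 1 < q ->
  Rintegral (leb2 R) (cbox (0, 0) q) (fun x => `|pot11 a r x|) <=
  432 * (ln (q + 2) - ln r).
Proof.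
move=> r01 a1 q1; have /andP[r0 r1] := r01.
have mb := @measurable_cbox R (0, 0) q.
have mp : measurable_fun setT (fun x => `|pot11 a r x|).
  apply: measurableT_comp => //; apply: continuous_measurable_fun2.
  exact: continuous_pot11.
pose I : R -> R := \1_(`[(- q)%R, q]%classic : set R).
pose k (x : R * R) := I x.1 * (108 / (r + `|x.1 - a| + `|x.2|) ^+ 2).
have mI : measurable_fun setT I by exact: measurable_indic.
have k0 x : 0 <= k x.
  by rewrite mulr_ge0 ?divr_ge0 ?sqr_ge0 // /I indicE ler0n.
have pos (x1 x2 : R) : 0 < r + `|x1 - a| + `|x2| by rewrite -addrA ltr_pwDl ?addr_ge0.
have ck : continuous (fun x : R * R => 108 / (r + `|x.1 - a| + `|x.2|) ^+ 2).
  move=> x; apply: cvgMr; apply: cvgV; first by rewrite sqrf_eq0 gt_eqF.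
  apply: (@cvg_comp _ _ _ (fun x : R * R => r + `|x.1 - a| + `|x.2|) (fun t => t ^+ 2));
    last exact: exprn_continuous.
  apply: cvgD.
    apply: cvgD; first exact: cvg_cst.
    apply: (@cvg_comp _ _ _ (fun x : R * R => x.1 - a) (fun t => `|t|)).
      exact: continuous_x1B.
    exact: norm_continuous.
  apply: (@cvg_comp _ _ _ (fun x : R * R => x.2) (fun t => `|t|)).
    exact: continuous_sndR.
  exact: norm_continuous.
have mk : measurable_fun setT k.
  apply: measurable_funM; first exact: measurableT_comp mI measurable_fst.
  exact: continuous_measurable_fun2.
have Tk : (\int[leb2 R]_x (k x)%:E <= (432 * (ln (q + 2) - ln r))%:E)%E.
  rewrite /leb2 fubini_tonelli1; last 2 first.
  - exact/measurable_EFinP.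
  - by move=> x; rewrite lee_fin.
  rewrite /fubini_F.
  have -> : (fun x : measurableTypeR R => \int[@lebesgue_measure R]_y (EFin \o k) (x, y))%E =
    (fun x => (216 * ((r + `|x - a|)^-1))%:E * (I x)%:E)%E.
    apply/funext => x; rewrite /k /=.
    have rx : 0 < r + `|x - a| by rewrite ltr_pwDl.
    transitivity (\int[@lebesgue_measure R]_y
      ((I x * 108)%:E * ((r + `|x - a| + `|y|) ^- 2)%:E))%E.
      by apply: eq_integral => y _; rewrite -EFinM mulrA.
    rewrite ge0_integralZl //.
    - rewrite integral_inv_dist2 // -!EFinM; congr EFin; field.
      by rewrite gt_eqF.
    - apply/measurable_EFinP; apply: continuous_measurable_fun => y.
      apply: cvgV; first by rewrite sqrf_eq0 gt_eqF.
      apply: (@cvg_comp _ _ _ (fun y => r + `|x - a| + `|y|) (fun t => t ^+ 2));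
        last exact: exprn_continuous.
      by apply: cvgD; [exact: cvg_cst|exact: norm_continuous].
    - by move=> y _; rewrite lee_fin invr_ge0 sqr_ge0.
    - by rewrite lee_fin mulr_ge0 // /I indicE ler0n.
  have mi : measurable (`[(- q)%R, q]%classic : set R) by exact: measurable_itv.
  have mdist : measurable_fun setT (fun x : R => (r + `|x - a|)^-1).
    apply: continuous_measurable_fun => x.
    apply: cvgV; first by rewrite gt_eqF // ltr_pwDl.
    apply: cvgD; first exact: cvg_cst.
    apply: (@cvg_comp _ _ _ (fun x => x - a) (fun t => `|t|)); last exact: norm_continuous.
    by apply: cvgB; [exact: cvg_id|exact: cvg_cst].
  have -> : (\int[@lebesgue_measure R]_x ((216 * (r + `|x - a|)^-1)%:E * (I x)%:E))%E =
    (216%:E * \int[@lebesgue_measure R]_(x in `[(- q)%R, q]) ((r + `|x - a|)^-1)%:E)%E.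
    rewrite -ge0_integralZl //; last 2 first.
    - by apply/measurable_EFinP; exact: measurable_funS mdist.
    - by move=> x _; rewrite lee_fin invr_ge0 addr_ge0 // ltW.
    rewrite [RHS]integral_mkcond; apply: eq_integral => x _.
    rewrite patchE /I indicE; case: ifP => _; rewrite ?mule1 ?mule0 //.
  have -> : 432 * (ln (q + 2) - ln r) = 216 * (2 * (ln (q + 2) - ln r)) :> R by ring.
  rewrite EFinM; apply: lee_wpmul2l; first by rewrite lee_fin.
  exact: integral_inv_dist.
have ik : (leb2 R).-integrable setT (EFin \o k).
  apply/integrableP; split; first exact/measurable_EFinP.
  apply: le_lt_trans (_ : _ <= (432 * (ln (q + 2) - ln r))%:E)%E (ltry _).
  apply: le_trans Tk; rewrite le_eqVlt; apply/orP; left; apply/eqP.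
  by apply: eq_integral => x _ /=; rewrite ger0_norm.
apply: (@le_trans _ _ (Rintegral (leb2 R) setT k)); last first.
  rewrite -lee_fin /Rintegral fineK //; exact: integrable_fin_num.
rewrite Rintegral_mkcond; apply: le_Rintegral => //.
- apply: integrable_dom ik => //.
    by apply/(measurable_restrictT _ _).1 => //; exact: measurable_funS mp.
  move=> x _; rewrite patchE; case: ifPn => [|_]; last by rewrite normr0.
  rewrite inE => -[/= x1 _]; rewrite normr_id /k /I indicE mem_set ?mul1r.
    exact: pot11_le_dist.
  by rewrite /= in_itv /= -ler_norml; move: x1; rewrite subr0.
- move=> x _; rewrite patchE; case: ifPn => [|_]; last exact: k0.
  rewrite inE => -[/= x1 _]; rewrite /k /I indicE mem_set ?mul1r.
    exact: pot11_le_dist.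
  by rewrite /= in_itv /= -ler_norml; move: x1; rewrite subr0.
Qed.

(** * Position of the discs *)

Definition ctr (R : realType) (k : nat) : R := 4^-1 ^+ k.
Definition rad (R : realType) (k : nat) : R := 4^-1 * ctr R k.
(** [N] is the number of smaller discs that compensate the negative part of the
    transform on a given disc; the bounds require [320 <= N]. *)
Definition ratio (R : realType) (N : nat) : R := 1 - (4 * N%:R)^-1.
(** The square leaves one factor [ratio R N ^+ k] to absorb the growth, linear in
    [k], of the local L^1 norm of [pot11 (ctr R k) (rad R k)]. *)
Definition mass (R : realType) (N k : nat) : R := (ratio R N ^+ k) ^+ 2.

Lemma ctr_gt0 (R : realType) k : 0 < ctr R k.
Proof. by rewrite exprn_gt0 // invr_gt0. Qed.

Lemma rad_gt0 (R : realType) k : 0 < rad R k.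
Proof. by rewrite mulr_gt0 ?ctr_gt0 // invr_gt0. Qed.

Lemma ctr_anti (R : realType) k n : (k < n)%N -> 4 * ctr R n <= ctr R k.
Proof.
move=> kn; have c4 : 4 * ctr R n = ctr R n.-1.
  by case: n kn => // n _; rewrite /ctr exprS mulrA mulfV ?mul1r //.
rewrite c4; apply: ler_wiXn2l; rewrite ?invr_ge0 //; last by case: n kn c4.
by rewrite invf_le1 // ler1n.
Qed.

Lemma ctr_le1 (R : realType) k : ctr R k <= 1.
Proof. by rewrite exprn_ile1 ?invr_ge0 // invf_le1 // ler1n. Qed.

Lemma ctr_le_inv (R : realType) k : ctr R k <= k.+1%:R^-1.
Proof.
rewrite /ctr exprVn lef_pV2 ?posrE ?exprn_gt0 ?ltr0n //.
by rewrite -natrX ler_nat ltn_expl.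
Qed.

Lemma ratio_inv (R : realType) N : (0 < N)%N ->
  0 < (4 * N%:R)^-1 :> R /\ (4 * N%:R)^-1 <= 4^-1 :> R.
Proof.
move=> N0; have n1 : 1 <= N%:R :> R by rewrite ler1n.
have n0 : 0 < N%:R :> R by rewrite ltr0n.
split; first by rewrite invr_gt0 mulr_gt0.
rewrite lef_pV2 ?posrE ?mulr_gt0 //; lra.
Qed.

Lemma ratio_gt0 (R : realType) N : (0 < N)%N -> 0 < ratio R N.
Proof. by move=> /(ratio_inv R)[]; rewrite /ratio; lra. Qed.

Lemma ratio_le1 (R : realType) N : (0 < N)%N -> ratio R N <= 1.
Proof. by move=> /(ratio_inv R)[]; rewrite /ratio; lra. Qed.

Lemma mass_gt0 (R : realType) N k : (0 < N)%N -> 0 < mass R N k.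
Proof. by move=> N0; rewrite !exprn_gt0 // ratio_gt0. Qed.

Lemma sum_ratio_le (R : realType) N n : (0 < N)%N ->
  \sum_(0 <= k < n) ratio R N ^+ k <= 4 * N%:R.
Proof.
move=> N0; have nn : N%:R != 0 :> R by rewrite pnatr_eq0 -lt0n.
have -> : \sum_(0 <= k < n) ratio R N ^+ k = 4 * N%:R * (1 - ratio R N ^+ n).
  elim: n => [|n IH]; first by rewrite big_nil expr0 subrr mulr0.
  by rewrite big_nat_recr //= IH exprS; set t := _ ^+ n; rewrite /ratio; field.
rewrite ler_piMr ?mulr_ge0 //.
have := exprn_ge0 n (ltW (ratio_gt0 R N0)); lra.
Qed.

(** The powers decrease, so [n] copies of the last one are at most the geometric sum. This pays for
    the logarithmic norms of the transforms, which grow linearly with the index. *)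
Lemma mul_ratio_le (R : realType) N n : (0 < N)%N -> n%:R * ratio R N ^+ n <= 4 * N%:R.
Proof.
move=> N0; apply: le_trans (sum_ratio_le R n N0).
have -> : n%:R * ratio R N ^+ n = \sum_(0 <= k < n) ratio R N ^+ n.
  by rewrite sumr_const_nat subn0 mulr_natl.
rewrite !big_mkord; apply: ler_sum => i _.
apply: ler_wiXn2l; [exact/ltW/ratio_gt0|exact: ratio_le1|exact: ltnW].
Qed.

Lemma bernoulli_ratio (R : realType) N n : (0 < N)%N ->
  1 - n%:R * (4 * N%:R)^-1 <= ratio R N ^+ n.
Proof.
move=> N0; elim: n => [|n IH]; first by rewrite mul0r subr0 expr0.
rewrite exprS -natr1; have r0 := ratio_gt0 R N0.
apply: le_trans (ler_wpM2l (ltW r0) IH).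
have [i0 i1] := ratio_inv R N0.
have n0 : 0 <= n%:R :> R by rewrite ler0n.
by rewrite /ratio; set t := (4 * _)^-1 in i0 i1 *; nra.
Qed.

(** Bernoulli's inequality with exponent [2 * i <= 2 * N] loses at most [2 * N / (4 * N) = 1 / 2],
    which explains the factor 4 in [ratio]. *)
Lemma mass_tail (R : realType) N j i : (0 < N)%N -> (i <= N)%N ->
  mass R N j / 2 <= mass R N (j + i).
Proof.
move=> N0 iN; rewrite /mass exprD exprMn ler_wpM2l //.
  by rewrite !exprn_ge0 // ltW // ratio_gt0.
rewrite -exprM; apply: le_trans (bernoulli_ratio R (i * 2) N0).
have n0 : 0 < N%:R :> R by rewrite ltr0n.
have : (i * 2)%:R * (4 * N%:R)^-1 <= 1 / 2 :> R.
  rewrite ler_pdivrMr ?mulr_gt0 // natrM.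
  have : i%:R <= N%:R :> R by rewrite ler_nat.
  lra.
lra.
Qed.

(** * Signs and lower bounds of the transforms on the discs *)

Lemma pot11_outside_ge0 (R : realType) (a r : R) (x : R * R) : 0 < r ->
  `|x.2| <= `|x.1 - a| -> r < `|x.1 - a| -> 0 <= pot11 a r x.
Proof.
move=> r0 x21 ra.
have s1 : 1 < rsq a r x.
  by apply: rsq_gt1 => // -[/= h _]; move: ra; rewrite ltNge h.
have [p0 _ _ _ [-> _]] := pot_far r0 s1.
rewrite divr_ge0 ?sqr_ge0 // mulr_ge0 // subr_ge0.
by rewrite -real_normK ?num_real // -[leRHS]real_normK ?num_real // lerXn2r ?nnegrE.
Qed.

(** The term with [prof2] is nonnegative on the disc and is dropped; [prof1] is at least [- 3]. *)
Lemma pot11_inside_ge (R : realType) (a r : R) (x : R * R) : 0 < r ->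
  rsq a r x <= 1 -> - (6 / r ^+ 2) <= pot11 a r x.
Proof.
move=> r0 s1; have s0 := rsq_ge0 a r x; rewrite /pot11 /prof1 /prof2 s1.
set s := rsq a r x in s0 s1 *; have q0 := sqr_ge0 (2 * (x.1 - a) / r ^+ 2).
have k0 : 0 <= 2 / r ^+ 2 by rewrite divr_ge0 // exprn_ge0 // ltW.
have -> : - (6 / r ^+ 2) = 2 / r ^+ 2 * (- 3) by ring.
rewrite -[leLHS]addr0; apply: lerD.
  by apply: ler_wpM2l => //; nra.
by apply: mulr_ge0 => //; lra.
Qed.

(** Here [A] is the abscissa of the centre of the disc containing [x], and [a] the centre of a
    smaller disc. In this range [x.2 ^+ 2] is at most a quarter of [(x.1 - a) ^+ 2], so the
    numerator of the point-mass kernel cannot degenerate. *)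
Lemma pot11_cone_ge (R : realType) (a r A : R) (x : R * R) : 0 < r -> 0 < A ->
  r < A / 2 -> A / 2 <= x.1 - a -> x.1 - a <= 5 / 4 * A -> `|x.2| <= A / 4 ->
  3 / 5 / A ^+ 2 <= pot11 a r x.
Proof.
move=> r0 A0 rA X1 X2 Y.
have s1 : 1 < rsq a r x.
  apply: rsq_gt1 => // -[/= h _]; move: h; rewrite leNgt ger0_norm; last by lra.
  by rewrite (lt_le_trans rA X1).
have [p0 _ _ _ [-> _]] := pot_far r0 s1.
set X := x.1 - a in X1 X2 p0 *; set W := x.2 ^+ 2 in p0 *.
have W0 : 0 <= W by exact: sqr_ge0.
have W1 : W <= A ^+ 2 / 16.
  have -> : A ^+ 2 / 16 = (A / 4) ^+ 2 by field.
  by rewrite /W -real_normK ?num_real // lerXn2r ?nnegrE //; lra.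
have T1 : A ^+ 2 / 4 <= X ^+ 2.
  have -> : A ^+ 2 / 4 = (A / 2) ^+ 2 by field.
  by rewrite lerXn2r ?nnegrE //; lra.
have T2 : X ^+ 2 <= 25 / 16 * A ^+ 2.
  have -> : 25 / 16 * A ^+ 2 = (5 / 4 * A) ^+ 2 by field.
  by rewrite lerXn2r ?nnegrE //; lra.
have A2 : 0 < A ^+ 2 by rewrite exprn_gt0.
set T := X ^+ 2 in p0 T1 T2 *; set B := A ^+ 2 in W1 T1 T2 A2 *.
rewrite ler_pdivlMr ?exprn_gt0 // mulrAC ler_pdivrMr //.
(* One factor [T + W] is replaced by its upper bound; what remains is linear in [T] and [W], up to
   the common factor [B]. *)
have h1 : (T + W) ^+ 2 <= (T + W) * (13 / 8 * B) by rewrite expr2 ler_wpM2l //; lra.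
have h2 : 3 / 5 * ((T + W) * (13 / 8 * B)) <= 2 * (T - W) * B by nra.
by apply: le_trans h2; rewrite ler_wpM2l.
Qed.

Lemma disc_coords (R : realType) (j : nat) (x : R * R) :
  rsq (ctr R j) (rad R j) x <= 1 ->
  [/\ 3 / 4 * ctr R j <= x.1, x.1 <= 5 / 4 * ctr R j & `|x.2| <= ctr R j / 4].
Proof.
move=> /(rsq_le1_norm (rad_gt0 R j)); rewrite ler_norml /rad => -[/andP[h1 h2] h3].
by split; lra.
Qed.

Lemma potential_sum_ge0 (R : realType) (N j n : nat) (x : R * R) :
  (0 < N)%N -> 320 <= N%:R :> R ->
  rsq (ctr R j) (rad R j) x <= 1 -> (j.+1 + N <= n)%N ->
  0 <= \sum_(0 <= k < n) mass R N k * pot11 (ctr R k) (rad R k) x.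
Proof.
move=> N0 N320 xj jn; have [x1 x2 x3] := disc_coords xj.
have A0 := ctr_gt0 R j; set A := ctr R j in x1 x2 x3 A0 *.
have m0 k := ltW (mass_gt0 R k N0).
rewrite (@big_cat_nat _ _ _ j.+1) //=; last by rewrite (leq_trans _ jn) // leq_addr.
rewrite (@big_cat_nat _ _ _ (j.+1 + N) j.+1 n) /=; [|exact: leq_addr|exact: jn].
have far k : (j < k)%N -> 3 / 5 / A ^+ 2 <= pot11 (ctr R k) (rad R k) x.
  move=> jk; have ck := ctr_anti R jk; have c0 := ctr_gt0 R k; rewrite -/A in ck.
  by apply: pot11_cone_ge => //; rewrite ?rad_gt0 // /rad; lra.
have A2 : 0 <= 3 / 5 / A ^+ 2 by rewrite divr_ge0 ?sqr_ge0 //; lra.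
have h1 : - (96 / A ^+ 2 * mass R N j) <=
    \sum_(0 <= k < j.+1) mass R N k * pot11 (ctr R k) (rad R k) x.
  rewrite big_nat_recr //= -[leLHS]add0r; apply: lerD.
    (* The larger discs lie to the right of [x] and see it within the cone where the kernel is
       nonnegative; only the last term, that of the disc itself, can be negative. *)
    rewrite big_mkord; apply: sumr_ge0 => k _; apply: mulr_ge0 => //.
    have ck := ctr_anti R (ltn_ord k); have c0 := ctr_gt0 R k; rewrite -/A in ck.
    apply: pot11_outside_ge0; first exact: rad_gt0.
      by rewrite [leRHS]ler0_norm; lra.
    by rewrite ler0_norm /rad; lra.
  have := pot11_inside_ge (rad_gt0 R j) xj.
  have -> : 6 / rad R j ^+ 2 = 96 / A ^+ 2 by rewrite /rad -/A; field; rewrite gt_eqF.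
  move=> h; rewrite mulrC -mulrN; exact: ler_wpM2l.
have h2 : 96 / A ^+ 2 * mass R N j <=
    \sum_(j.+1 <= k < j.+1 + N) mass R N k * pot11 (ctr R k) (rad R k) x.
  apply: (@le_trans _ _
      (\sum_(j.+1 <= k < j.+1 + N) (mass R N j / 2 * (3 / 5 / A ^+ 2)))).
    rewrite sumr_const_nat addKn -[leRHS]mulr_natl.
    (* The balance that fixes 320: each of the next [N] discs brings [3 / 5 / A ^+ 2] with a weight
       of at least [mass R N j / 2]. *)
    have -> : 96 / A ^+ 2 * mass R N j = 320 * (mass R N j / 2 * (3 / 5 / A ^+ 2)).
      by field; rewrite gt_eqF.
    by apply: ler_wpM2r => //; apply: mulr_ge0 => //; apply: divr_ge0.
  apply: ler_sum_nat => k /andP[jk kj].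
  apply: ler_pM; [by apply: divr_ge0|exact: A2| |exact: far].
  have -> : k = (j + (k - j))%N by rewrite subnKC // ltnW.
  apply: mass_tail => //; rewrite leq_subLR.
  by move: kj; rewrite addSn ltnS.
have h3 : 0 <= \sum_(j.+1 + N <= k < n) mass R N k * pot11 (ctr R k) (rad R k) x.
  rewrite big_nat_cond; apply: sumr_ge0 => k /andP[/andP[jk _] _].
  apply: mulr_ge0 => //; apply: le_trans A2 (far _ _).
  by apply: leq_trans jk; rewrite leq_addr.
lra.
Qed.

(** * The essential support of W and its nontriviality *)

Lemma open_outside_discs (R : realType) (K : nat) :
  open [set y : R * R | forall k, (k < K)%N -> 1 < rsq (ctr R k) (rad R k) y].
Proof.
elim: K => [|K IH].
  rewrite (_ : mkset _ = setT); first exact: openT.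
  by apply/seteqP; split.
rewrite (_ : mkset _ = [set y | forall k, (k < K)%N -> 1 < rsq (ctr R k) (rad R k) y]
  `&` (rsq (ctr R K) (rad R K) @^-1` [set t | 1 < t])).
  apply: openI => //; apply: open_comp; last exact: open_gt.
  by move=> y _; exact: continuous_rsq.
apply/seteqP; split => y /= h.
  by split=> [k kK|]; apply: h => //; rewrite ltnS ltnW.
by move=> k; rewrite ltnS leq_eqVlt => /predU1P[->|]; [exact: h.2|exact: h.1].
Qed.

Lemma bump_disc_out (R : realType) (k : nat) (x : R * R) :
  1 < rsq (ctr R k) (rad R k) x -> bump (ctr R k) (rad R k) x = 0.
Proof. by move=> s1; rewrite /bump /cap leNgt s1 mulr0. Qed.

Definition Wsum (R : realType) (N : nat) : R * R -> R :=
  fser (fun k x => mass R N k * bump (ctr R k) (rad R k) x).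

Lemma Wsum_eq0 (R : realType) (N : nat) (x : R * R) :
  (forall k, 1 < rsq (ctr R k) (rad R k) x) -> Wsum N x = 0.
Proof.
move=> h; apply: fser_cvg; rewrite (_ : (fun n => _) = fun=> 0); first exact: cvg_cst.
apply/funext => n; rewrite big1 // => k _; by rewrite bump_disc_out ?mulr0.
Qed.

(** The closed discs accumulate only at the origin, which belongs to the support but to no disc. The
    condition [x.1 != 0] excludes it: any other point off the axis has a neighbourhood that meets
    finitely many discs, and none if it lies outside all of them. The axis is a null set, so the
    final almost-everywhere statement can ignore it. *)
Lemma Wsum_support (R : realType) (N : nat) (x : R * R) : x.1 != 0 -> ess_support (@Wsum R N) x ->
  exists j, rsq (ctr R j) (rad R j) x <= 1.
Proof.
move=> x0 xS; apply/not_existsP => hx.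
have {}hx k : 1 < rsq (ctr R k) (rad R k) x by rewrite ltNge; apply/negP.
have vanish (U : set (R * R)) : open U -> U x ->
    ~ (forall y, U y -> forall k, 1 < rsq (ctr R k) (rad R k) y).
  move=> oU Ux h; apply: (xS U oU Ux); apply: aeW => y Uy.
  by apply: Wsum_eq0; exact: h.
have neg (y : R * R) k : y.1 < 3 / 4 * ctr R k -> 1 < rsq (ctr R k) (rad R k) y.
  by move=> h; rewrite ltNge; apply/negP => /disc_coords[]; lra.
have big (y : R * R) k : 5 / 4 * ctr R k < y.1 -> 1 < rsq (ctr R k) (rad R k) y.
  by move=> h; rewrite ltNge; apply/negP => /disc_coords[]; lra.
case: (ltgtP x.1 0) x0 => // x10 _.
  apply: (vanish [set y : R * R | y.1 < 0]) => //.
    apply: (@open_comp _ _ (fun y : R * R => y.1) [set t | t < 0]); last exact: open_lt.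
    by move=> y _; exact: continuous_fstR.
  by move=> y /= y0 k; apply: neg; have := ctr_gt0 R k; lra.
have x40 : 0 < x.1 / 4 by rewrite divr_gt0.
(* From the index [K] on, all discs lie to the left of [x.1 / 2], since
   [5 / 4 * (x.1 / 4) < x.1 / 2]. *)
have [K _ hK] := near_infty_natSinv_lt (PosNum x40).
apply: (vanish ([set y : R * R | x.1 / 2 < y.1] `&`
  [set y : R * R | forall k, (k < K)%N -> 1 < rsq (ctr R k) (rad R k) y])).
- apply: openI; last exact: open_outside_discs.
  apply: (@open_comp _ _ (fun y : R * R => y.1) [set t | x.1 / 2 < t]); last exact: open_gt.
  by move=> y _; exact: continuous_fstR.
- by split => //=; lra.
- move=> y [/= y1 y2] k; case: (ltnP k K) => [/y2 //|kK].
  have h : ctr R k < x.1 / 4 := le_lt_trans (ctr_le_inv R k) (hK k kK).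
  by apply: big; move: y1 => /=; lra.
Qed.

(** This square of positive measure lies in the disc of index 0, centred at [(1, 0)]; all other
    discs stay in [x.1 <= 5 / 16], so a single bump contributes. *)
Lemma Wsum_pos (R : realType) (N : nat) (x : R * R) : cbox (1, 0) (16^-1) x -> 0 < Wsum N x.
Proof.
move=> [/=]; rewrite subr0 ler_norml => /andP[x1 x1'] x2.
have c0 : ctr R 0 = 1 by rewrite /ctr expr0.
have E : Wsum N x = bump 1 (4^-1) x.
  apply: fser_cvg; apply: cvg_near_cst; exists 1%N => // n /= n1.
  rewrite big_ltn // big_nat_cond big1 ?addr0.
    by rewrite /rad c0 /mass expr0 expr1n mul1r mulr1.
  move=> k /andP[/andP[k1 _] _]; rewrite bump_disc_out ?mulr0 //.
  rewrite ltNge; apply/negP => /disc_coords[_ h _].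
  have h4 := ctr_anti R k1.
  have := ctr_gt0 R k; lra.
have s1 : rsq 1 (4^-1) x <= 1 / 8.
  have w2 : x.2 ^+ 2 <= 256^-1.
    have -> : 256^-1 = (16^-1) ^+ 2 :> R by field.
    by rewrite -real_normK ?num_real // lerXn2r ?nnegrE.
  have w1 : (x.1 - 1) ^+ 2 <= 256^-1 by nra.
  rewrite /rsq ler_pdivrMr; last by rewrite exprn_gt0 // invr_gt0.
  have -> : (4^-1) ^+ 2 = 16^-1 :> R by field.
  lra.
have r2 : 0 < (4^-1) ^+ 2 :> R by rewrite exprn_gt0 // invr_gt0.
rewrite E /bump /cap ifT; last by lra.
by apply: mulr_gt0; [exact: divr_gt0|apply: exprn_gt0; lra].
Qed.

(** * The function W and its transform *)

Definition gsum (R : realType) (N : nat) : R * R -> R :=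
  fser (fun k x => mass R N k * pot11 (ctr R k) (rad R k) x).

Lemma mass_le_ratio (R : realType) N k : (0 < N)%N -> mass R N k <= ratio R N ^+ k.
Proof.
move=> N0; rewrite /mass expr2 ler_piMr ?exprn_ge0 ?(ltW (ratio_gt0 R N0)) //.
by rewrite exprn_ile1 // ?ratio_le1 // ltW // ratio_gt0.
Qed.

Lemma Rintegral_normZ (R : realType) (D : set (R * R)) (k : R) (h : R * R -> R) :
  measurable D -> 0 <= k -> (leb2 R).-integrable D (EFin \o h) ->
  Rintegral (leb2 R) D (fun x => `|k * h x|) = k * Rintegral (leb2 R) D (fun x => `|h x|).
Proof.
move=> mD k0 hi; rewrite -RintegralZl //; last exact: integrable_norm.
by apply: eq_Rintegral => x _; rewrite normrM ger0_norm.
Qed.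

Lemma measurable_mass_bump (R : realType) N k :
  measurable_fun setT (fun x => mass R N k * bump (ctr R k) (rad R k) x).
Proof.
apply: measurable_funM => //; apply: continuous_measurable_fun2.
exact: continuous_bump.
Qed.

Lemma measurable_mass_pot11 (R : realType) N k :
  measurable_fun setT (fun x => mass R N k * pot11 (ctr R k) (rad R k) x).
Proof.
apply: measurable_funM => //; apply: continuous_measurable_fun2.
exact: continuous_pot11.
Qed.

Lemma Wsum_integral (R : realType) (N : nat) : (0 < N)%N ->
  (leb2 R).-integrable setT (EFin \o @Wsum R N) /\
  forall (psi : R * R -> R) (P : R), measurable_fun setT psi ->
    (forall x, setT x -> `|psi x| <= P) ->
    \sum_(0 <= k < n) Rintegral (leb2 R) setT
      (fun x => mass R N k * bump (ctr R k) (rad R k) x * psi x) @[n --> \oo] -->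
    Rintegral (leb2 R) setT (fun x => Wsum N x * psi x).
Proof.
move=> N0; apply: (@fser_integral _ _ R (leb2 R) setT _
  (fun k => 48 * ratio R N ^+ k) (48 * (4 * N%:R))) => //.
- exact: measurable_mass_bump.
- by move=> k; apply: integrable_scale; exact: (integrable_bump _ (rad_gt0 R k)).1.
- move=> k; have [i b] := integrable_bump (ctr R k) (rad_gt0 R k).
  rewrite Rintegral_normZ ?(ltW (mass_gt0 R k N0)) // [leLHS]mulrC.
  apply: ler_pM => //; first exact: Rintegral_ge0.
    exact/ltW/mass_gt0.
  exact: mass_le_ratio.
- by move=> n; rewrite -mulr_sumr ler_wpM2l //; exact: sum_ratio_le.
Qed.

Lemma ln_rad (R : realType) k : - ln (rad R k) = k.+1%:R * ln 4.
Proof.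
rewrite /rad /ctr -exprS lnXn ?invr_gt0 // lnV ?posrE //.
by rewrite mulNrn opprK mulr_natl.
Qed.

Lemma pot11_integrable_cbox (R : realType) (a r q : R) : 0 < r ->
  (leb2 R).-integrable (cbox (0, 0) q) (EFin \o pot11 a r).
Proof.
move=> r0; have mb := @measurable_cbox R (0, 0) q.
have q0 : 0 <= `|q| by [].
apply: measurable_bounded_integrable => //.
- have h : (leb2 R (cbox (0, 0)%R q) <= leb2 R (cbox (0, 0)%R `|q|%R))%E.
    apply: le_measure; rewrite ?inE //; first exact: measurable_cbox.
    by move=> x [x1 x2]; split; apply: le_trans (ler_norm q).
  apply: (le_lt_trans h).
  by rewrite [X in (X < _)%E](_ : _ = (4 * `|q| ^+ 2)%:E) ?ltry //; exact: leb2_cbox.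
- by apply: measurable_funS (continuous_measurable_fun2 (@continuous_pot11 R a r)).
- exists (18 / r ^+ 2); split=> [|M /ltW h x _]; first exact: num_real.
  exact: le_trans (pot11_le _ _ r0) h.
Qed.

(** Only boxes are possible: the norm of the k-th term over a box of half-side [q] grows with both
    [ln (q + 2)] and [k], and after multiplication by the weight it is at most [C * ratio R N ^+ k],
    with [C] depending on [q]. *)
Lemma gsum_integral (R : realType) (N : nat) (q : R) : (0 < N)%N -> 1 < q ->
  (leb2 R).-integrable (cbox (0, 0) q) (EFin \o @gsum R N) /\
  forall (psi : R * R -> R) (P : R), measurable_fun (cbox (0, 0) q) psi ->
    (forall x, cbox (0, 0) q x -> `|psi x| <= P) ->
    \sum_(0 <= k < n) Rintegral (leb2 R) (cbox (0, 0) q)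
      (fun x => mass R N k * pot11 (ctr R k) (rad R k) x * psi x) @[n --> \oo] -->
    Rintegral (leb2 R) (cbox (0, 0) q) (fun x => gsum N x * psi x).
Proof.
move=> N0 q1; have mb := @measurable_cbox R (0, 0) q.
have r0 := ratio_gt0 R N0.
have l4 : 0 <= ln 4 :> R by rewrite ln_ge0 // ler1n.
have lq : 0 <= ln (q + 2) by rewrite ln_ge0 //; lra.
have n0 : 0 <= N%:R :> R by [].
have [K K0 KE] : exists2 K : R, 0 <= K & 432 = K by exists 432; rewrite ?ler0n.
pose C := K * (ln (q + 2) + ln 4 + ln 4 * (4 * N%:R)).
have C0 : 0 <= C.
  apply: mulr_ge0 => //; apply: addr_ge0; first exact: addr_ge0.
  by apply: mulr_ge0 => //; apply: mulr_ge0.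
apply: (@fser_integral _ _ R (leb2 R) _ _
  (fun k => C * ratio R N ^+ k) (C * (4 * N%:R))) => //.
- exact: measurable_mass_pot11.
- move=> k; have hi := pot11_integrable_cbox (ctr R k) q (rad_gt0 R k).
  rewrite (_ : _ \o _ = (fun x => (mass R N k)%:E * (pot11 (ctr R k) (rad R k) x)%:E)%E) //.
  by apply: integrableZl.
- move=> k; rewrite Rintegral_normZ ?(ltW (mass_gt0 R k N0)) //; last first.
    exact: pot11_integrable_cbox (rad_gt0 R k).
  have c0 := ctr_gt0 R k; have c1 := ctr_le1 R k.
  have H : Rintegral (leb2 R) (cbox (0, 0) q) (fun x => `|pot11 (ctr R k) (rad R k) x|)
      <= 432 * (ln (q + 2) - ln (rad R k)).
    apply: pot11_box_integral => //; last by rewrite gtr0_norm.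
    by rewrite rad_gt0 /= /rad; lra.
  rewrite ln_rad KE in H.
  apply: le_trans (ler_wpM2l (ltW (mass_gt0 R k N0)) H) _.
  have p0 : 0 <= ratio R N ^+ k by rewrite exprn_ge0 // ltW.
  have p1 : ratio R N ^+ k <= 1 by rewrite exprn_ile1 ?ratio_le1 // ltW.
  have pk := mul_ratio_le R k N0.
  rewrite /mass expr2 -(natr1 k) /C; set p := ratio R N ^+ k in p0 p1 pk *.
  set L := ln (q + 2) in lq *; set l := ln 4 in l4 *.
  have -> : p * p * (K * (L + (k%:R + 1) * l)) =
    p * (K * (p * L + p * l + l * (k%:R * p))) by ring.
  (* One factor [p] is kept for the geometric sum; the other turns [k * p] into the bound
     [4 * N]. *)
  rewrite [leRHS]mulrC; apply: ler_wpM2l => //; apply: ler_wpM2l => //.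
  apply: lerD; last by apply: ler_wpM2l.
  by apply: lerD; rewrite ler_piMl.
- by move=> n; rewrite -mulr_sumr ler_wpM2l //; exact: sum_ratio_le.
Qed.

Lemma gsum_Lloc (R : realType) (N : nat) : (0 < N)%N -> Lloc (@gsum R N).
Proof.
move=> N0; split; first by apply: measurable_fser => k; exact: measurable_mass_pot11.
move=> r; have q1 : 1 < `|r| + 2 by rewrite ltr_wpDl // ltr1n.
have [gi _] := gsum_integral N0 q1.
apply: integrableS gi; first exact: measurable_cbox.
  have := @measurable_cbox R (0, 0) r; congr measurable.
  by apply/seteqP; split => x /=; rewrite /cbox /= !subr0.
move=> x [x1 x2]; split; rewrite /= subr0.
- by apply: le_trans x1 _; rewrite (le_trans (ler_norm r)) // lerDl.
- by apply: le_trans x2 _; rewrite (le_trans (ler_norm r)) // lerDl.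
Qed.

(** Both sides are limits of series whose terms agree by [pairing_bump]. On the left [dual_pot] is
    merely bounded but W is integrable on the whole plane; on the right [gsum] is merely locally
    integrable but [phi] lives in a box. *)
Lemma pairing_Wsum (R : realType) (N : nat) (phi : R * R -> R) (c : R) :
  (0 < N)%N -> test_fun phi ->
  pairing (@R1sq_symbol R) phi c (@Wsum R N) =
  cos c * (4 * pi ^+ 2) * Rintegral (leb2 R) setT (fun x => gsum N x * phi x).
Proof.
move=> N0 [cphi [[r0 phi0] [LC LS]]].
pose q := `|r0| + 2.
have q1 : 1 < q by rewrite ltr_wpDl // ltr1n.
have phiq x : ~ cbox (0, 0) q x -> phi x = 0.
  move=> xb; apply: phi0 => -[x1 x2]; apply: xb; split; rewrite /= subr0.
  - by apply: le_trans x1 _; rewrite (le_trans (ler_norm r0)) // lerDl.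
  - by apply: le_trans x2 _; rewrite (le_trans (ler_norm r0)) // lerDl.
have mb := @measurable_cbox R (0, 0) q.
have [M phiM] := continuous_cbox_bounded cphi phiq.
have phii := continuous_cbox_integrable cphi phiq.
have mphi := continuous_measurable_fun2 cphi.
have mm := @measurable_R1sq_symbol R; have m1 := @R1sq_symbol_le1 R.
have [P hP] := dual_pot_bounded c mm m1 LC LS.
have mP := measurable_dual_pot c mm m1 LC LS.
have [Wi Wc] := Wsum_integral R N0.
have [gi gc] := gsum_integral N0 q1.
have restr (h : R * R -> R) : Rintegral (leb2 R) setT (fun x => h x * phi x) =
    Rintegral (leb2 R) (cbox (0, 0) q) (fun x => h x * phi x).
  rewrite [RHS]Rintegral_mkcond; apply: eq_Rintegral => x _.
  rewrite patchE; case: ifPn => // /negP hx.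
  by rewrite phiq ?mulr0 // => /mem_set.
rewrite pairing_swap // restr.
have {}Wc := Wc _ P mP (fun x _ => hP x).
have {}gc := gc _ M (measurable_funS measurableT (@subsetT _ _) mphi) (fun x _ => phiM x).
have {}gc : cos c * (4 * pi ^+ 2) * \sum_(0 <= k < n) Rintegral (leb2 R) (cbox (0, 0) q)
    (fun x => mass R N k * pot11 (ctr R k) (rad R k) x * phi x) @[n --> \oo] -->
    cos c * (4 * pi ^+ 2) * Rintegral (leb2 R) (cbox (0, 0) q) (fun x => gsum N x * phi x).
  by apply: cvgMr.
suff E n : \sum_(0 <= k < n) Rintegral (leb2 R) setT (fun x => mass R N k *
      bump (ctr R k) (rad R k) x * dual_pot (@R1sq_symbol R) phi c x) =
    cos c * (4 * pi ^+ 2) * \sum_(0 <= k < n) Rintegral (leb2 R) (cbox (0, 0) q)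
      (fun x => mass R N k * pot11 (ctr R k) (rad R k) x * phi x).
  by rewrite (funext E) in Wc; exact: (cvg_unique (@Rhausdorff R) Wc gc).
rewrite mulr_sumr; apply: eq_bigr => k _.
have rk := rad_gt0 R k.
rewrite -(restr (fun x => mass R N k * pot11 (ctr R k) (rad R k) x)).
have ib := (integrable_bump (ctr R k) rk).1.
transitivity (mass R N k * (cos c * (4 * pi ^+ 2) *
    Rintegral (leb2 R) setT (fun x => pot11 (ctr R k) (rad R k) x * phi x))); last first.
  rewrite mulrCA; congr (_ * _); rewrite -RintegralZl //.
    by apply: eq_Rintegral => x _; rewrite mulrA.
  apply: integrable_mul_bounded (fun x => pot11_le _ x rk) phii.
  by apply: continuous_measurable_fun2; exact: continuous_pot11.
rewrite -(pairing_bump c (ctr R k) cphi phiM phii LC LS rk) pairing_swap // -RintegralZl //.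
  by apply: eq_Rintegral => x _; rewrite mulrA.
by apply: (@integrableMr_bounded _ _ _ _ _ _ _ P) => //.
Qed.

Lemma ft_phase0 (R : realType) (f : R * R -> R) : ft_phase 0 f = ft_cos f.
Proof. by apply/funext => xi; apply: eq_Rintegral => x _; rewrite addr0. Qed.

Lemma ft_phaseNpihalf (R : realType) (f : R * R -> R) :
  ft_phase (0 - pi / 2) f = ft_sin f.
Proof.
by apply/funext => xi; apply: eq_Rintegral => x _; rewrite sub0r -sin_cosBpihalf.
Qed.

Lemma ft_phase_pihalf (R : realType) (f : R * R -> R) (xi : R * R) :
  (leb2 R).-integrable setT (EFin \o f) ->
  ft_phase (pi / 2) f xi = - ft_sin f xi.
Proof.
move=> fi; rewrite -mulN1r /ft_sin -RintegralZl //; last exact: integrable_sinl.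
by apply: eq_Rintegral => x _; rewrite cosD cos_pihalf sin_pihalf; ring.
Qed.

(** The phase [0] yields the equation for the integral of [gsum] against [phi]; at [pi / 2] the
    factor [cos c] vanishes and yields the zero imaginary part. *)
Lemma is_R1sq_Wsum (R : realType) (N : nat) : (0 < N)%N -> is_R1sq (@Wsum R N) (@gsum R N).
Proof.
move=> N0; split; first exact: gsum_Lloc.
move=> phi tphi; have [Wi _] := Wsum_integral R N0; split.
- have := pairing_Wsum 0 N0 tphi; rewrite cos0 mul1r /pairing ft_phase0 ft_phaseNpihalf => ->.
  have p0 : 4 * pi ^+ 2 != 0 :> R by rewrite mulf_neq0 // expf_neq0 // gt_eqF // pi_gt0.
  by rewrite mulrA mulVf // mul1r.
- have := pairing_Wsum (pi / 2) N0 tphi; rewrite cos_pihalf !mul0r => <-.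
  rewrite /pairing subrr ft_phase0; apply: eq_Rintegral => xi _.
  by rewrite ft_phase_pihalf //; ring.
Qed.

Lemma line_negligible (R : realType) : (leb2 R).-negligible [set x : R * R | x.1 = 0].
Proof.
have m0 : measurable ([set 0] : set R) by exact: measurable_set1.
exists (([set 0] : set R) `*` ([set: R])); split.
- exact: measurableX.
- rewrite /leb2 product_measure1E //.
  transitivity (0 * lebesgue_measure [set: R])%E; last by rewrite mul0e.
  by congr (_ * _)%E; exact: lebesgue_measure_set1.
- by move=> x /= ->.
Qed.

Lemma gsum_ge0_support (R : realType) (N : nat) : (0 < N)%N -> 320 <= N%:R :> R ->
  {ae leb2 R, forall x, ess_support (@Wsum R N) x -> 0 <= gsum N x}.
Proof.
move=> N0 N320; apply: negligibleS (@line_negligible R) => x /= hx.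
apply: contrapT => /eqP x0; apply: hx => xS.
have [j xj] := Wsum_support x0 xS.
by apply: (@fser_ge0 _ _ _ _ (j.+1 + N)) => n jn; exact: potential_sum_ge0 N0 N320 xj jn.
Qed.

Lemma Wsum_nontrivial (R : realType) (N : nat) : ~ {ae leb2 R, forall x, Wsum N x = 0 :> R}.
Proof.
move=> [A [mA A0 sA]].
have : (leb2 R (cbox (1, 0)%R 16^-1%R) <= leb2 R A)%E.
  apply: le_measure; rewrite ?inE //; first exact: measurable_cbox.
  by move=> x /Wsum_pos /= h; apply: sA => /= e; move: (h N); rewrite e ltxx.
rewrite A0 leb2_cbox ?invr_ge0 // lee_fin leNgt => /negP; apply.
by rewrite mulr_gt0 // exprn_gt0 // invr_gt0.
Qed.

Lemma Wsum_ge0 (R : realType) (N : nat) (x : R * R) : (0 < N)%N -> 0 <= Wsum N x.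
Proof.
move=> N0; apply: (@fser_ge0 _ _ _ _ 0%N) => n _; apply: sumr_ge0 => k _.
by rewrite mulr_ge0 ?bump_ge0 // ltW // mass_gt0.
Qed.

Unset Implicit Arguments.

Theorem theorem3p2 (R : realType) :
  exists W : R * R -> R,
    [/\ L1 W,
        (forall x, 0 <= W x),
        ~ {ae leb2 R, forall x, W x = 0} &
        exists g : R * R -> R,
          is_R1sq W g /\
          {ae leb2 R, forall x, ess_support W x -> 0 <= g x}].
Proof.
have [N N0 N320] : exists2 N, (0 < N)%N & 320 <= N%:R :> R by exists 320%N.
exists (@Wsum R N); split.
- split; last exact: (Wsum_integral R N0).1.
  by apply: measurable_fser => k; exact: measurable_mass_bump.
- by move=> x; exact: Wsum_ge0.
- exact: Wsum_nontrivial.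
- by exists (@gsum R N); split; [exact: is_R1sq_Wsum|exact: gsum_ge0_support].
Qed.
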